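(* For each countable ordinal $\alpha\ge\omega+\omega$, the partial order $\langle\mathbb P(\alpha),\subset\rangle$ is forcing equivalent to a two-step iteration of the form $(P(\omega)/\mathrm{Fin})^+\ast\pi$, where $[\omega]\Vdash$ ''$\pi$ is an $\omega_1$-closed, separative, atomless forcing''.
   Context: For an ordinal $\alpha$, $\mathbb P(\alpha)=\{A\subset\alpha:\langle A,\in\rangle\cong\langle\alpha,\in\rangle\}$, ordered by inclusion. $(P(\omega)/\mathrm{Fin})^+$ is the poset of nonzero elements of $P(\omega)$ modulo finite sets, with top element $[\omega]$. Forcing equivalent means producing the same generic extensions. $\omega_1$-closed: every countable decreasing sequence has a lower bound; separative: whenever $p\not\le q$ there is $r\le p$ incompatible with $q$. *)

(* Defs.v *)
From HB Require Import structures.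
From mathcomp Require Import all_boot all_order.
From mathcomp Require Import boolp classical_sets functions cardinality.
From mathcomp Require Import wochoice.

Set Implicit Arguments.
Unset Strict Implicit.
Unset Printing Implicit Defensive.

Import Order.TTheory.
Local Open Scope classical_set_scope.
Local Open Scope order_scope.
Local Open Scope quotient_scope.

(* A forcing notion is a preorder with a largest element: tPreorderType.
   p <= q means that p is stronger than q.  The universe Type plays the role
   of the ground model V. *)

Fact forcing_display : Order.disp_t. Proof. exact: Order.Disp tt tt. Qed.

(* P-names: Name elt cond stands for the name {(elt i, cond i) : i in I}. *)
Inductive name (P : Type) : Type :=
  Name (I : Type) (elt : I -> name P) (cond : I -> P).

Definition dom (P : Type) (x : name P) : Type :=
  let: Name T _ _ := x in T.
Definition elt (P : Type) (x : name P) : dom x -> name P :=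
  let: Name _ e _ := x in e.
Definition cond (P : Type) (x : name P) : dom x -> P :=
  let: Name _ _ c := x in c.

(* A sentence of the forcing language is identified with the set of the
   conditions that force it. *)
Definition sentence (P : Type) := P -> Prop.
Definition forces (P : Type) (p : P) (phi : sentence P) : Prop := phi p.

Declare Scope sentence_scope.
Delimit Scope sentence_scope with F.
Bind Scope sentence_scope with sentence.

Notation "p ||- phi" := (forces p phi%F) (at level 70, no associativity).

Section ForcingRelation.
Context {d : Order.disp_t} {P : tPreorderType d}.
Implicit Types (p q r : P) (x y z : name P) (phi psi : sentence P).

Definition dense_below p (A : P -> Prop) : Prop :=
  forall q, q <= p -> exists2 r, r <= q & A r.

(* p ||- x = y iff, for every (u, s) in x, every q below both p and s forces
   u \in y, and symmetrically; here q ||- u \in y means that the r such that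
   r <= t and r ||- u = v for some (v, t) in y are dense below q. *)
Fixpoint feq x y : sentence P :=
  let: Name _ ex cx := x in
  let: Name _ ey cy := y in
  fun p =>
    (forall i q, q <= p -> q <= cx i ->
       dense_below q (fun r => exists2 j, r <= cy j & feq (ex i) (ey j) r)) /\
    (forall j q, q <= p -> q <= cy j ->
       dense_below q (fun r => exists2 i, r <= cx i & feq (ex i) (ey j) r)).

Definition fmem x y : sentence P := fun p =>
  dense_below p (fun q => exists2 j : dom y, q <= cond j & feq x (elt j) q).

Definition fand phi psi : sentence P := fun p => phi p /\ psi p.
Definition fimp phi psi : sentence P := fun p =>
  forall q, q <= p -> phi q -> psi q.
Definition fnot phi : sentence P := fun p => forall q, q <= p -> ~ phi q.
Definition fall (T : Type) (F : T -> sentence P) : sentence P := fun p =>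
  forall t, F t p.
Definition fex (T : Type) (F : T -> sentence P) : sentence P := fun p =>
  dense_below p (fun q => exists t, F t q).
(* an assertion about the ground model *)
Definition fground (A : Prop) : sentence P := fun=> A.

End ForcingRelation.

Notation "A /\ B" := (fand A B) : sentence_scope.
Notation "A -> B" := (fimp A B) : sentence_scope.
Notation "~ A" := (fnot A) : sentence_scope.
Notation "'Forall' x .. y , A" := (fall (fun x => .. (fall (fun y => A%F)) ..))
  (at level 200, x binder, y binder, right associativity) : sentence_scope.
Notation "'Exists' x .. y , A" := (fex (fun x => .. (fex (fun y => A%F)) ..))
  (at level 200, x binder, y binder, right associativity) : sentence_scope.
Notation "'Forall_' ( x 'in' X ) , A" := (fall (fun x => fimp (fmem x X) A%F))
  (at level 200, x name, X at level 50, right associativity) : sentence_scope.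
Notation "'Exists_' ( x 'in' X ) , A" := (fex (fun x => fand (fmem x X) A%F))
  (at level 200, x name, X at level 50, right associativity) : sentence_scope.

Section Names.
Context {d : Order.disp_t} {P : tPreorderType d}.
Implicit Types x y : name P.

Definition upair_name x y : name P :=
  Name (fun b : bool => if b then x else y) (fun=> \top).

(* Kuratowski pair *)
Definition opair_name x y : name P :=
  upair_name (upair_name x x) (upair_name x y).

(* the canonical name of the von Neumann natural number n *)
Fixpoint nat_name (n : nat) : name P :=
  if n is m.+1 then
    Name (fun o : option (dom (nat_name m)) =>
            if o is Some i then elt i else nat_name m)
         (fun o => if o is Some i then cond i else \top)
  else Name (fun e : void => match e return name P with end) (fun=> \top).

End Names.

(* A P-name for a forcing notion: names for the underlying set and for the
   order, a set of ordered pairs, and an element of the domain of the former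
   naming the largest element. *)
Record po_name (P : Type) := PoName {
  po_set : name P;
  po_rel : name P;
  po_top : dom po_set }.

Section ForcingNames.
Context {d : Order.disp_t} {P : tPreorderType d}.
Implicit Types (pi : po_name P) (x y f : name P).

Definition fle pi x y : sentence P := fmem (opair_name x y) (po_rel pi).

Definition is_forcing pi : sentence P :=
  (fmem (elt (po_top pi)) (po_set pi) /\
  (Forall_(x in po_set pi), fle pi x x) /\
  (Forall_(x in po_set pi), Forall_(y in po_set pi), Forall_(z in po_set pi),
     fle pi x y /\ fle pi y z -> fle pi x z) /\
  (Forall_(x in po_set pi), fle pi x (elt (po_top pi))))%F.

Definition fcompatible pi x y : sentence P :=
  (Exists_(z in po_set pi), fle pi z x /\ fle pi z y)%F.

(* f is a function from omega to the underlying set of pi; the canonical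
   names nat_name n, for n : nat, name exactly the elements of omega. *)
Definition is_sequence pi f : sentence P :=
  ((Forall_(z in f), Exists n : nat,
      Exists_(x in po_set pi), feq z (opair_name (nat_name n) x)) /\
  (Forall n : nat, Exists_(x in po_set pi), fmem (opair_name (nat_name n) x) f) /\
  (Forall (n : nat) (x y : name P),
      fmem (opair_name (nat_name n) x) f /\ fmem (opair_name (nat_name n) y) f
      -> feq x y))%F.

Definition is_decreasing pi f : sentence P :=
  (Forall (n : nat) (x y : name P),
     fmem (opair_name (nat_name n) x) f /\ fmem (opair_name (nat_name n.+1) y) f
     -> fle pi y x)%F.

Definition omega1_closed pi : sentence P :=
  (Forall f : name P, is_sequence pi f /\ is_decreasing pi f ->
     Exists_(z in po_set pi), Forall (n : nat) (x : name P),
       fmem (opair_name (nat_name n) x) f -> fle pi z x)%F.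

Definition separative pi : sentence P :=
  (Forall_(x in po_set pi), Forall_(y in po_set pi),
     ~ fle pi x y ->
     Exists_(z in po_set pi), fle pi z x /\ ~ fcompatible pi z y)%F.

Definition atomless pi : sentence P :=
  (Forall_(x in po_set pi), Exists_(y in po_set pi), Exists_(z in po_set pi),
     fle pi y x /\ fle pi z x /\ ~ fcompatible pi y z)%F.

End ForcingNames.

Record forcing_name (d : Order.disp_t) (P : tPreorderType d) := ForcingName {
  fname :> po_name P;
  fnameP : \top ||- is_forcing fname }.

Section Iteration.
Context {d : Order.disp_t} {P : tPreorderType d}.

Lemma dense_below_le (p q : P) (A : P -> Prop) :
  q <= p -> dense_below p A -> dense_below q A.
Proof. by move=> qp dA r rq; apply: dA; apply: le_trans qp. Qed.

Variable pi : forcing_name P.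

(* The conditions of P * pi: the pairs (p, x) with x in the domain of the name
   of the underlying set of pi and p ||- x \in pi. *)
Definition iteration : Type :=
  {c : P * dom (po_set pi) | c.1 ||- fmem (elt c.2) (po_set pi)}.

HB.instance Definition _ := gen_eqMixin iteration.
HB.instance Definition _ := gen_choiceMixin iteration.

Definition iteration_le (b c : iteration) : bool :=
  ((sval b).1 <= (sval c).1) &&
  `[< (sval b).1 ||- fle pi (elt (sval b).2) (elt (sval c).2) >].

Lemma iteration_le_refl : reflexive iteration_le.
Proof.
move=> [[p i] /= pi_i]; apply/andP; split => //=; apply/asboolP.
have [_ [refl _]] := fnameP pi.
exact: (refl (elt i) p (lex1 p) pi_i).
Qed.

Lemma iteration_le_trans : transitive iteration_le.
Proof.
move=> [[q j] /= qj] [[p i] /= pi_i] [[r k] /= rk].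
rewrite /iteration_le /= => /andP[pq /asboolP leij] /andP[qr /asboolP lejk].
have pr := le_trans pq qr; apply/andP; split => //; apply/asboolP.
have [_ [_ [tr _]]] := fnameP pi.
have jk : p ||- fle pi (elt j) (elt k) by apply: dense_below_le lejk.
exact: (tr (elt i) p (lex1 p) pi_i (elt j) p (lexx p) (dense_below_le pq qj)
  (elt k) p (lexx p) (dense_below_le pr rk) p (lexx p) (conj leij jk)).
Qed.

HB.instance Definition _ := Order.Le_isPreorder.Build forcing_display
  iteration iteration_le_refl iteration_le_trans.

Lemma iteration_top_proof :
  (\top : P) ||- fmem (elt (po_top pi)) (po_set pi).
Proof. by have [] := fnameP pi. Qed.

Definition iteration_top : iteration :=
  exist _ (\top, po_top pi) iteration_top_proof.

Lemma iteration_le_top (c : iteration) : c <= iteration_top.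
Proof.
case: c => [[p i] /= pi_i]; apply/andP; split; first exact: lex1.
apply/asboolP; have [_ [_ [_ top]]] := fnameP pi.
exact: (top (elt i) p (lex1 p) pi_i).
Qed.

HB.instance Definition _ := Order.hasTop.Build forcing_display
  iteration iteration_le_top.

End Iteration.

Section ForcingEquivalence.

(* A P-name for a subset of Q in the ground model, as a set of pairs (q, p). *)
Definition subset_name (Q P : Type) := Q -> P -> Prop.

Definition fin {d : Order.disp_t} {P : tPreorderType d} (Q : Type)
    (q : Q) (H : subset_name Q P) : sentence P := fun p =>
  dense_below p (fun r => exists2 s, H q s & r <= s).

(* H is a Q-generic filter over V. *)
Definition is_generic {d d' : Order.disp_t} {P : tPreorderType d}
    (Q : tPreorderType d') (H : subset_name Q P) : sentence P :=
  (fin \top H /\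
  (Forall q q' : Q, fin q H /\ fground (q <= q') -> fin q' H) /\
  (Forall q q' : Q, fin q H /\ fin q' H ->
     Exists r : Q, fground (r <= q /\ r <= q') /\ fin r H) /\
  (Forall D : Q -> Prop, fground (dense_below \top D) ->
     Exists q : Q, fground (D q) /\ fin q H))%F.

(* The P-name of the evaluation of the Q-name x by the filter named by H: a
   pair (y, q) of x contributes the value of y as soon as q is in H. *)
Fixpoint eval (Q P : Type) (H : subset_name Q P) (x : name Q) : name P :=
  let: Name J e c := x in
  Name (fun k : {k : J * P | H (c k.1) k.2} => eval H (e (sval k).1))
       (fun k => (sval k).2).

(* "V[G] = V[H]", where G is the canonical name of the P-generic filter, that
   is: every P-name has the same value as some Q-name evaluated by H.  The
   inclusion of V[H] in V[G] is automatic, as eval H x is a P-name. *)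
Definition same_extension {d : Order.disp_t} {P : tPreorderType d} (Q : Type)
    (H : subset_name Q P) : sentence P :=
  (Forall x : name P, Exists y : name Q, feq x (eval H y))%F.

(* Every generic extension by P is a generic extension by Q. *)
Definition extensions_included {d d' : Order.disp_t} (P : tPreorderType d)
    (Q : tPreorderType d') : Prop :=
  (\top : P) ||- Exists H : subset_name Q P,
    is_generic H /\ same_extension H.

Definition forcing_equivalent {d d' : Order.disp_t} (P : tPreorderType d)
    (Q : tPreorderType d') : Prop :=
  extensions_included P Q /\ extensions_included Q P.

End ForcingEquivalence.

Section PomegaFin.

Definition almost_eq (A B : set nat) : bool :=
  `[< finite_set (A `\` B) /\ finite_set (B `\` A) >].

Lemma finite_setD_trans (T : Type) (A B C : set T) :
  finite_set (A `\` B) -> finite_set (B `\` C) -> finite_set (A `\` C).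
Proof.
move=> fAB fBC; apply: (@sub_finite_set _ _ ((A `\` B) `|` (B `\` C))).
  by move=> x [Ax nCx]; have [Bx|nBx] := pselect (B x); [right|left].
by rewrite finite_setU.
Qed.

Lemma almost_eq_refl : reflexive almost_eq.
Proof. by move=> A; apply/asboolP; rewrite setDv; split. Qed.

Lemma almost_eq_sym : symmetric almost_eq.
Proof.
by move=> A B; apply/asboolP/asboolP => -[]; split.
Qed.

Lemma almost_eq_trans : transitive almost_eq.
Proof.
move=> B A C /asboolP[AB BA] /asboolP[BC CB]; apply/asboolP; split.
  exact: finite_setD_trans AB BC.
exact: finite_setD_trans CB BA.
Qed.

Canonical almost_eq_equiv :=
  EquivRel almost_eq almost_eq_refl almost_eq_sym almost_eq_trans.

Definition PomegaFin : Type := {eq_quot almost_eq}.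
HB.instance Definition _ := Choice.on PomegaFin.
HB.instance Definition _ := EqQuotient.on PomegaFin.

Definition PomegaFin_pos : Type :=
  {x : PomegaFin | x != \pi_PomegaFin set0}.
HB.instance Definition _ := Choice.on PomegaFin_pos.

(* [A] <= [B] iff A \ B is finite, which does not depend on the choice of the
   representatives *)
Definition PomegaFin_le (x y : PomegaFin_pos) : bool :=
  `[< finite_set (repr (val x) `\` repr (val y)) >].

Lemma PomegaFin_le_refl : reflexive PomegaFin_le.
Proof. by move=> x; apply/asboolP; rewrite setDv. Qed.

Lemma PomegaFin_le_trans : transitive PomegaFin_le.
Proof.
move=> y x z /asboolP xy /asboolP yz; apply/asboolP.
exact: finite_setD_trans xy yz.
Qed.

HB.instance Definition _ := Order.Le_isPreorder.Build forcing_display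
  PomegaFin_pos PomegaFin_le_refl PomegaFin_le_trans.

Lemma PomegaFin_top_proof :
  \pi_PomegaFin [set: nat] != \pi_PomegaFin set0.
Proof.
apply/negP => /eqP /eqmodP /asboolP[+ _].
by rewrite setD0; apply: infinite_nat.
Qed.

Definition PomegaFin_top : PomegaFin_pos :=
  exist _ (\pi_PomegaFin [set: nat]) PomegaFin_top_proof.

Lemma PomegaFin_le_top (x : PomegaFin_pos) : x <= PomegaFin_top.
Proof.
apply/asboolP => /=.
have : \pi_PomegaFin (repr (\pi_PomegaFin [set: nat])) =
       \pi_PomegaFin [set: nat] by rewrite reprK.
move=> /eqmodP /asboolP[_ fin]; apply: sub_finite_set fin.
by move=> n [_ ?]; split.
Qed.

HB.instance Definition _ := Order.hasTop.Build forcing_display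
  PomegaFin_pos PomegaFin_le_top.

End PomegaFin.

(* An ordinal is represented by a well-ordered type of that order type. *)
Section Copies.
Context {d : Order.disp_t} (alpha : orderType d).

(* (B, <) is isomorphic to (alpha, <) *)
Definition is_copy (B : set alpha) : Prop :=
  exists2 f : alpha -> alpha,
    set_bij [set: alpha] B f & {mono f : x y / x < y}.

Definition copies : Type := {B : set alpha | `[< is_copy B >]}.
HB.instance Definition _ := Choice.on copies.
HB.instance Definition _ := SubChoice.on copies.
HB.instance Definition _ := [SubChoice_isSubPOrder of copies by <:
  with forcing_display].

Lemma copies_top_proof : `[< is_copy [set: alpha] >].
Proof.
by apply/asboolP; exists id => //; split => // x _; exists x.
Qed.

Definition copies_top : copies := exist _ [set: alpha] copies_top_proof.

Lemma copies_le_top (B : copies) : B <= copies_top.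
Proof. by rewrite -Order.le_val; apply: lex1. Qed.

HB.instance Definition _ := Order.hasTop.Build _ copies copies_le_top.

End Copies.

(* For well orders, beta <= alpha as ordinals: beta is isomorphic to an
   initial segment of alpha. *)
Definition ordinal_le {d d' : Order.disp_t} (beta : orderType d)
    (alpha : orderType d') : Prop :=
  exists2 f : beta -> alpha, {mono f : x y / x < y} &
    forall (x : beta) (a : alpha), a <= f x -> exists y, f y = a.

(* Two copies of nat one after the other: omega + omega. *)
Definition omega_plus_omega := (bool *l nat)%type.

(* Main.v *)
(* A set of order type alpha is, up to passing to a subset, a "positive" subset B of
   alpha: one into which alpha embeds.  Write alpha = M + R, where M is the first
   additively indecomposable summand, and cut M into an omega-sequence of bounded
   indecomposable blocks.  A subset of M is positive iff, for each k, it embeds the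
   k-th block inside infinitely many blocks; hence, after grouping the blocks, the
   union U(X) of R and of the groups with index in X is positive exactly when X is
   infinite, and every positive B has an infinite X such that B meets U(Y) in a
   positive set for each infinite Y below X.  So X |-> U(X) embeds P(omega)/Fin
   completely into the positive sets, and pi names the quotient.  It is omega1-closed
   because P(omega)/Fin adds no new omega-sequences and because a decreasing sequence
   of positive sets has a diagonal pseudo-intersection, built block by block; it is
   atomless because either R has an infinite summand or, as alpha >= omega + omega,
   M has an infinite block, and an infinite indecomposable set splits into two
   disjoint sets each of which embeds it.  Finally B |-> B and (X, B) |-> B meet U(X)
   map the copies of alpha and the iteration densely into the positive sets. *)
Require Import Defs.
From mathcomp Require Import all_boot all_order.
From mathcomp Require Import boolp classical_sets functions cardinality wochoice.

Set Implicit Arguments.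
Unset Strict Implicit.
Unset Printing Implicit Defensive.

Import Order.TTheory.
Local Open Scope quotient_scope.
Local Open Scope order_scope.
Local Open Scope classical_set_scope.

(** * Forcing relation *)

Section ForcingRelationTheory.
Context {d : Order.disp_t} {P : tPreorderType d}.
Implicit Types (p q r : P) (x y z : name P) (A B : P -> Prop).

Lemma dense_below_now p A : (forall q, q <= p -> A q) -> dense_below p A.
Proof. by move=> Ap q qp; exists q => //; exact: Ap. Qed.

Lemma dense_below_bind p A B :
  dense_below p A -> (forall q, q <= p -> A q -> dense_below q B) ->
  dense_below p B.
Proof.
move=> dA AB q qp; have [r rq Ar] := dA q qp.
have [s sr Bs] := AB r (le_trans rq qp) Ar r (lexx _).
by exists s => //; apply: le_trans rq.
Qed.

Lemma feqE x y p : feq x y p <->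
  (forall (i : dom x) q, q <= p -> q <= cond i ->
     dense_below q (fun r => exists2 j : dom y, r <= cond j &
                                feq (elt i) (elt j) r)) /\
  (forall (j : dom y) q, q <= p -> q <= cond j ->
     dense_below q (fun r => exists2 i : dom x, r <= cond i &
                                feq (elt i) (elt j) r)).
Proof. by case: x => I e c; case: y => J e' c'. Qed.

Lemma feq_le x y p q : q <= p -> feq x y p -> feq x y q.
Proof.
move=> qp /feqE[xy yx]; apply/feqE.
by split=> i r rq; [apply: xy|apply: yx]; apply: le_trans qp.
Qed.

Lemma feq_refl x p : feq x x p.
Proof.
elim: x p => I e IH c p; apply/feqE.
by split=> i q _ qi; apply: dense_below_now => r rq; exists i => //=;
  apply: le_trans qi.
Qed.

Lemma feq_sym x y p : feq x y p -> feq y x p.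
Proof.
elim: x y p => I e IH c y p /feqE[xy yx]; apply/feqE.
split=> [j|i] q qp qi; [move: (yx j q qp qi)|move: (xy i q qp qi)];
  move/dense_below_bind; apply=> r _ [k rk kj]; apply: dense_below_now => s sr;
  (exists k; first exact: le_trans rk);
  by apply: IH; apply: feq_le kj.
Qed.

Lemma feq_trans x y z p : feq x y p -> feq y z p -> feq x z p.
Proof.
elim: x y z p => I e IH c y z p /feqE[xy yx] /feqE[yz zy]; apply/feqE.
split=> [i|k] q qp qi.
- move: (xy i q qp qi) => /dense_below_bind; apply=> r rq [j rj ij].
  move: (yz j r (le_trans rq qp) rj) => /dense_below_bind; apply=> s sr [k sk jk].
  apply: dense_below_now => t ts; exists k; first exact: le_trans sk.
  apply: feq_le ts _; apply: IH jk; exact: feq_le ij.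
- move: (zy k q qp qi) => /dense_below_bind; apply=> r rq [j rj ij].
  move: (yx j r (le_trans rq qp) rj) => /dense_below_bind; apply=> s sr [i si jk].
  apply: dense_below_now => t ts; exists i; first exact: le_trans si.
  apply: feq_le ts _; apply: IH jk _; exact: feq_le ij.
Qed.

Lemma fmem_le x y p q : q <= p -> fmem x y p -> fmem x y q.
Proof. exact: dense_below_le. Qed.

Lemma fmem_elt y (j : dom y) p : p <= cond j -> fmem (elt j) y p.
Proof.
move=> pj; apply: dense_below_now => q qp; exists j; first exact: le_trans pj.
exact: feq_refl.
Qed.

Lemma fmem_eql x y z p : feq x y p -> fmem x z p -> fmem y z p.
Proof.
move=> xy /dense_below_bind; apply=> q qp [j qj xj].
apply: dense_below_now => r rq; exists j; first exact: le_trans qj.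
apply: feq_trans (feq_le rq xj); apply/feq_sym.
by apply: feq_le xy; apply: le_trans qp.
Qed.

Lemma fmem_eqr x y z p : feq y z p -> fmem x y p -> fmem x z p.
Proof.
move=> /feqE[yz _] /dense_below_bind; apply=> q qp [j qj xj].
move: (yz j q qp qj) => /dense_below_bind; apply=> r rq [k rk jk].
apply: dense_below_now => s sr; exists k; first exact: le_trans rk.
exact: feq_le sr (feq_trans (feq_le rq xj) jk).
Qed.

(** Induction on the name: a witness that [x] lies in [x] is an element of [x] equal to [x], hence
    an element of itself. *)
Lemma fmem_irrefl x p : ~ fmem x x p.
Proof.
elim: x p => I e IH c p.
move=> /(_ p (lexx p))[q qp [j qj xj]]; apply: (IH j q).
apply: fmem_eqr xj _.
exact: (@fmem_elt (Name e c) j).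
Qed.

Lemma fmem_upairl x y p : fmem x (upair_name x y) p.
Proof. by apply: (@fmem_elt (upair_name x y) true); exact: lex1. Qed.

Lemma fmem_upairr x y p : fmem y (upair_name x y) p.
Proof. by apply: (@fmem_elt (upair_name x y) false); exact: lex1. Qed.

Lemma fmem_upair z x y p : fmem z (upair_name x y) p ->
  exists2 q, q <= p & feq z x q \/ feq z y q.
Proof.
move=> /(_ p (lexx p))[q qp [[] _ h]]; exists q => //; by [left|right].
Qed.

Lemma feq_upair x x' y y' p : feq x x' p -> feq y y' p ->
  feq (upair_name x y) (upair_name x' y') p.
Proof.
move=> xx yy; apply/feqE; split=> i q qp qi; apply: dense_below_now => r rq;
 exists i; rewrite ?lex1 //; case: i {qi} => /=;
 apply: feq_le (le_trans rq qp) _ => //.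
Qed.

Lemma feq_opair x x' y y' p : feq x x' p -> feq y y' p ->
  feq (opair_name x y) (opair_name x' y') p.
Proof. by move=> xx yy; do !apply: feq_upair. Qed.

Lemma fmem_nat_name m n p : (m < n)%N -> fmem (nat_name m) (nat_name n) p.
Proof.
elim: n => // n IH; rewrite ltnS leq_eqVlt => /orP[/eqP->|/IH].
  by apply: (@fmem_elt (nat_name n.+1) None); exact: lex1.
move/dense_below_bind; apply=> q _ [j qj ij]; apply: dense_below_now => r rq.
exists (Some j : dom (nat_name n.+1)); first exact: le_trans qj.
exact: feq_le ij.
Qed.

Lemma nat_name_inj m n p : feq (nat_name m) (nat_name n) p -> m = n.
Proof.
wlog mn : m n / (m < n)%N => [hw e|/feq_sym e].
  case: (ltngtP m n) => // [/hw|/hw]; first exact.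
  by move=> h; rewrite h //; apply: feq_sym.
by case: (@fmem_irrefl (nat_name m) p); apply: fmem_eqr e _; exact: fmem_nat_name.
Qed.

Section Codes.
Variables (S : Type) (c : S -> name P).
Hypothesis c_inj : forall s t p, feq (c s) (c t) p -> s = t.

(** Equality of two codes, once forced by any condition, is true equality; so a forced membership in
    a pair gives a genuine alternative, and the usual argument for Kuratowski pairs applies. *)
Lemma upair_code_inj s t s' t' p :
  feq (upair_name (c s) (c t)) (upair_name (c s') (c t')) p ->
  ((s = s' \/ s = t') /\ (t = s' \/ t = t')) /\
  ((s' = s \/ s' = t) /\ (t' = s \/ t' = t)).
Proof.
have mem u v w q : fmem (c u) (upair_name (c v) (c w)) q -> u = v \/ u = w.
  by move=> /fmem_upair[r _ [/c_inj|/c_inj]]; [left|right].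
move=> e; have e' := feq_sym e.
split; split; apply: (mem _ _ _ p).
- by apply: (fmem_eqr e); exact: fmem_upairl.
- by apply: (fmem_eqr e); exact: fmem_upairr.
- by apply: (fmem_eqr e'); exact: fmem_upairl.
- by apply: (fmem_eqr e'); exact: fmem_upairr.
Qed.

Lemma opair_code_inj s t s' t' p :
  feq (opair_name (c s) (c t)) (opair_name (c s') (c t')) p ->
  s = s' /\ t = t'.
Proof.
move=> e; have e' := feq_sym e.
have [q _ h1] := fmem_upair (fmem_eqr e (@fmem_upairl _ _ _)).
have [q2 _ h2] := fmem_upair (fmem_eqr e (@fmem_upairr _ _ _)).
have [q3 _ h3] := fmem_upair (fmem_eqr e' (@fmem_upairr _ _ _)).
have {h1} ss : s = s'.
  by case: h1 => /upair_code_inj[[]]; [|move=> _ _ [[]]]; case.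
subst s'; split=> //.
case: h2 => /upair_code_inj[[_ ht] [_ ht']]; last by case: ht; case: ht'; congruence.
by case: h3 => /upair_code_inj[[_ kt] [_ kt']]; case: ht; case: kt; case: kt'; congruence.
Qed.

End Codes.

End ForcingRelationTheory.

(* Two forcings with dense, order and incompatibility preserving maps [a], [b]
   into a common preorder: the name [{(q, p) : a p <= b q}] of a Q-generic filter
   generates the whole extension by [P]. *)
Section DenseMaps.
Context {d d' : Order.disp_t} {P : tPreorderType d} {Q : tPreorderType d'}.
Variables (M : Type) (leM : M -> M -> Prop) (a : P -> M) (b : Q -> M).
Hypotheses
  (leM_refl : forall m, leM m m)
  (leM_trans : forall m n o, leM m n -> leM n o -> leM m o)
  (a_mono : forall p p', p <= p' -> leM (a p) (a p'))
  (b_mono : forall q q', q <= q' -> leM (b q) (b q'))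
  (a_dense : forall m, exists p, leM (a p) m)
  (b_dense : forall m, exists q, leM (b q) m)
  (a_compat : forall m p p', leM m (a p) -> leM m (a p') ->
     exists2 r, r <= p & r <= p')
  (b_compat : forall m q q', leM m (b q) -> leM m (b q') ->
     exists2 r, r <= q & r <= q').

(** Density puts some [a p'] below [m]; compatibility, applied at [a p'], yields a common extension
    of [p'] and [p]. *)
Let a_below m p : leM m (a p) -> exists2 r, r <= p & leM (a r) m.
Proof.
move=> mp; have [p' p'm] := a_dense m.
have [r rp rp'] := a_compat (leM_trans p'm mp) (leM_refl _).
by exists r => //; apply: leM_trans p'm; apply: a_mono.
Qed.

Let b_below m q : leM m (b q) -> exists2 r, r <= q & leM (b r) m.
Proof.
move=> mq; have [q' q'm] := b_dense m.
have [r rq rq'] := b_compat (leM_trans q'm mq) (leM_refl _).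
by exists r => //; apply: leM_trans q'm; apply: b_mono.
Qed.

Let H : subset_name Q P := fun q p => leM (a p) (b q).

Let finE q p : fin q H p <-> dense_below p (fun r => leM (a r) (b q)).
Proof.
split=> /dense_below_bind; apply=> r _.
  move=> [s sq rs]; apply: dense_below_now => t tr.
  by apply: leM_trans sq; apply: a_mono; apply: le_trans rs.
by move=> rq; apply: dense_below_now => s sr; exists r.
Qed.

Let H_generic p : p ||- is_generic H.
Proof.
split; [|split; [|split]].
- apply/finE => r _; have [q qr] := b_dense (a r).
  have [s sr sq] := a_below qr; exists s => //.
  by apply: (leM_trans sq); apply: b_mono; exact: lex1.
- move=> q q' r _ [/finE qr qq']; apply/finE.
  apply: (dense_below_bind qr) => s _ sq; apply: dense_below_now => t ts.
  by apply: (leM_trans (a_mono ts)); apply: (leM_trans sq); exact: b_mono.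
- move=> q q' r _ [/finE qr /finE qr'].
  apply: (dense_below_bind qr) => s sr sq.
  apply: (dense_below_bind (dense_below_le sr qr')) => t ts tq' u ut.
  (* Descend alternately in [Q] and in [P]: [q2] extends [q] and [q'], and [v] below [u] forces it
     into the filter. *)
  have [q1 q1q q1u] : exists2 q1, q1 <= q & leM (b q1) (a u).
    apply: b_below; apply: leM_trans sq; apply: a_mono.
    exact: le_trans ts.
  have [q2 q21 q2q'] : exists2 q2, q2 <= q1 & q2 <= q'.
    apply: (b_compat (leM_refl _)); apply: leM_trans tq'.
    by apply: (leM_trans q1u); exact: a_mono.
  have [v vu vq2] : exists2 v, v <= u & leM (a v) (b q2).
    by apply: a_below; apply: leM_trans q1u; exact: b_mono.
  exists v => //; exists q2; split; first by split=> //; apply: le_trans q1q.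
  by apply/finE; apply: dense_below_now => w wv; apply: leM_trans vq2; exact: a_mono.
- move=> D r _ denD s _.
  have [q qs] := b_dense (a s).
  have [q' q'q Dq'] := denD q (lex1 _).
  have [t ts tq'] := a_below (leM_trans (b_mono q'q) qs).
  exists t => //; exists q'; split=> //.
  by apply/finE; apply: dense_below_now => w wv; apply: leM_trans tq'; exact: a_mono.
Qed.

(** A condition [c j] is replaced by the conditions of [Q] below it in [M]; by density one of them
    is in the Q-generic filter whenever [c j] is in the P-generic one. *)
Fixpoint translate (x : name P) : name Q :=
  let: Name J e c := x in
  Name (fun k : {k : J * Q | leM (b k.2) (a (c k.1))} =>
          translate (e (sval k).1))
       (fun k => (sval k).2).

Let feq_translate x p : feq x (eval H (translate x)) p.
Proof.
elim: x p => I e IH c p; apply/feqE; split=> /= [i q qp qi|].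
  move=> r rq.
  have [q1 q1r] := b_dense (a r).
  have [s sr sq1] := a_below q1r.
  have h : leM (b q1) (a (c i)).
    by apply: (leM_trans q1r); apply: a_mono; apply: le_trans qi.
  pose k : {k : I * Q | leM (b k.2) (a (c k.1))} := exist _ (i, q1) h.
  exists s => //; exists (exist _ (k, s) sq1) => //=.
move=> [[[[i q1] /= h] s] /= hs] q qp qs r rq.
(* In [M] the condition [r] lies below [s], [q1] and [c i]; compatibility pulls this back to a
   common extension in [P]. *)
have [t tr ti] : exists2 t, t <= r & t <= c i.
  apply: (@a_compat (a r)) => //; apply: leM_trans h.
  by apply: leM_trans hs; apply: a_mono; apply: le_trans qs.
by exists t => //; exists i.
Qed.

Lemma extensions_included_dense : extensions_included P Q.
Proof.
move=> p _; exists p => //; exists H; split; first exact: H_generic.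
by move=> x q qp; exists q => //; exists (translate x); exact: feq_translate.
Qed.

End DenseMaps.

Lemma increasing_choice (R : nat -> nat -> Prop) :
  (forall k N, exists2 n, (N <= n)%N & R k n) ->
  exists u : nat -> nat,
    {homo u : m n / (m < n)%N} /\ forall k, R k (u k).
Proof.
move=> h; have /choice[F HF] : forall kN : nat * nat, exists n,
    (kN.2 <= n)%N /\ R kN.1 n by move=> [k N]; have [n] := h k N; exists n.
pose fix u n := if n is m.+1 then F (m.+1, (u m).+1) else F (0, 0)%N.
exists u; split=> [|[|k]]; [|by have [] := HF (0, 0)%N|by have [] := HF (k.+1, (u k).+1)].
by apply: homo_ltn; [exact: ltn_trans|move=> k /=; have [] := HF (k.+1, (u k).+1)].
Qed.

(** * Embeddings between subsets of a well order *)

Section WellOrder.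
Context {d : Order.disp_t} {alpha : orderType d}.
Hypothesis wo : forall A : set alpha, A !=set0 ->
  exists2 x, A x & forall y, A y -> x <= y.
Implicit Types (A B C D T : set alpha) (a b x y z : alpha).

Lemma wo_ind (Q : alpha -> Prop) :
  (forall x, (forall y, y < x -> Q y) -> Q x) -> forall x, Q x.
Proof.
move=> IH x; apply: contrapT => nQ.
have [y nQy ymin] := wo (ex_intro (fun y => ~ Q y) x nQ).
apply: nQy; apply: IH => z zy; apply: contrapT => nQz.
by have := ymin z nQz; rewrite leNgt zy.
Qed.

Lemma wo_wf : well_founded (fun y x : alpha => y < x).
Proof. by apply: wo_ind => x IH; constructor. Qed.

(** On a well order this compares order types; the values of [f] outside [A] are arbitrary. *)
Definition emb A B := exists f : alpha -> alpha,
  (forall x, A x -> B (f x)) /\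
  (forall x y, A x -> A y -> x < y -> f x < f y).

Definition tail a : set alpha := [set x | a <= x].
Definition head a : set alpha := [set x | x < a].
Definition ival a b : set alpha := [set x | a <= x /\ x < b].

(* additively indecomposable, for a nonempty [A] *)
Definition indec A := forall a, A a -> emb A (A `&` tail a).

Lemma sub_emb A B : A `<=` B -> emb A B.
Proof. by move=> AB; exists id. Qed.

Lemma emb_refl A : emb A A.
Proof. exact: sub_emb. Qed.

Lemma emb_trans A B C : emb A B -> emb B C -> emb A C.
Proof.
move=> [f [fAB fm]] [g [gBC gm]]; exists (g \o f); split=> [x /fAB/gBC//|x y Ax Ay xy].
by apply: gm; [exact: fAB|exact: fAB|exact: fm].
Qed.

Lemma emb_subr A B C : B `<=` C -> emb A B -> emb A C.
Proof. by move=> BC AB; apply: emb_trans AB _; exact: sub_emb. Qed.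

(** The image of a least point moved down would be a smaller such point. *)
Lemma self_emb_ge A (f : alpha -> alpha) :
  (forall x, A x -> A (f x)) ->
  (forall x y, A x -> A y -> x < y -> f x < f y) ->
  forall x, A x -> x <= f x.
Proof.
move=> fA fm x Ax; rewrite leNgt; apply/negP => fx.
have [y [Ay fy] ymin] := wo (ex_intro (fun x => A x /\ f x < x) x (conj Ax fx)).
have := ymin (f y) (conj (fA _ Ay) (fm _ _ (fA _ Ay) Ay fy)).
by rewrite leNgt fy.
Qed.

(** Transfinite recursion sends each point to the least element of [B] above all earlier values. If
    it never stops, [A] embeds into [B]; if it first stops at [a], the values below [a] exhaust [B],
    and the inverse map embeds [B] below [a]. *)
Lemma emb_cmp A B : emb A B \/ exists2 a, A a & emb B (A `&` head a).
Proof.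
have [[a0 _]|/set0P/negP] := pselect (A !=set0); last first.
  rewrite negbK => /eqP ->; left; exact: sub_emb.
have /choice[m mP] : forall D : set alpha, exists x,
    D !=set0 -> D x /\ forall y, D y -> x <= y.
  move=> D; have [/wo[x Dx xm]|nD] := pselect (D !=set0); first by exists x.
  by exists a0.
pose step x (rec : forall y, y < x -> alpha) :=
  m [set b | B b /\ forall y (yx : y < x), A y -> rec y yx < b].
pose f := Fix wo_wf (fun=> alpha) step.
have fE x : f x = m [set b | B b /\ forall y, y < x -> A y -> f y < b].
  rewrite /f Fix_eq // => z g h gh; congr (m _); apply/seteqP.
  by split=> b [Bb bm]; split=> // y yz Ay; move: (bm y yz Ay); rewrite gh.
pose ok x := exists b, B b /\ forall y, y < x -> A y -> f y < b.
have fP x : ok x -> (B (f x) /\ forall y, y < x -> A y -> f y < f x) /\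
    forall b, B b -> (forall y, y < x -> A y -> f y < b) -> f x <= b.
  move=> okx; have [h1 h2] := mP _ okx; rewrite fE; split=> // b Bb bm.
  by apply: h2; split.
have [[a [Aa nok]]|/forallNP allok] := pselect (exists x, A x /\ ~ ok x); last first.
  left; exists f; split=> [x Ax|x y Ax Ay xy].
    by have /not_andP[//|/contrapT/fP[[]]] := allok x.
  by have /not_andP[//|/contrapT/fP[[_ h] _]] := allok y; exact: h.
right.
have {Aa nok}[{}a [Aa nok] amin] :=
  wo (ex_intro (fun x => A x /\ ~ ok x) a (conj Aa nok)).
have okA y : A y -> y < a -> ok y.
  move=> Ay ya; apply: contrapT => noky.
  by have := amin y (conj Ay noky); rewrite leNgt ya.
exists a => //.
(* Since [b] is not above all the values, some value reaches it; at the first such [y], [b] is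
   itself an admissible value, which forces [f y = b]. *)
have /choice[g gP] : forall b, exists y, B b -> [/\ A y, y < a & f y = b].
  move=> b; have [Bb|] := pselect (B b); last by exists b.
  have : exists y, [/\ A y, y < a & b <= f y].
    apply: contrapT => /forallNP h; apply: nok; exists b; split=> // y ya Ay.
    by rewrite ltNge; apply/negP => bf; apply: (h y).
  move=> /wo[y [Ay ya bf] ymin]; exists y => _; split=> //.
  have [[_ _] fmin] := fP y (okA y Ay ya).
  apply/eqP; rewrite eq_le bf andbT; apply: fmin => // z zy Az.
  rewrite ltNge; apply/negP => bfz.
  by have := ymin z (And3 Az (lt_trans zy ya) bfz); rewrite leNgt zy.
exists g; split=> [b /gP[]//|b c /gP[Ab ba fb] /gP[Ac ca fc] bc].
rewrite ltNge; apply/negP; rewrite le_eqVlt => /orP[/eqP e|cb].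
  by move: bc; rewrite -fb -fc e ltxx.
have [[_ h] _] := fP _ (okA _ Ab ba).
by move: (h _ cb Ac); rewrite fb fc ltNge (ltW bc).
Qed.

Lemma emb_total A B : emb A B \/ emb B A.
Proof.
have [|[a _ h]] := emb_cmp A B; [by left|right].
by apply: emb_subr h => x [].
Qed.

Lemma indec_tail D : D !=set0 -> exists2 a, D a & indec (D `&` tail a).
Proof.
move=> [d0 Dd0].
(* [tail a] of least order type: no later tail embeds in a proper initial segment *)
suff [a Da amin] : exists2 a, D a & forall b c, D b -> D c -> a <= b -> a <= c ->
    ~ emb (D `&` tail b) (D `&` tail a `&` head c).
  exists a => // b [Db ab].
  have [//|[c [Dc ac] h]] := emb_cmp (D `&` tail a) (D `&` tail a `&` tail b).
  exfalso; apply: (amin b c) => //.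
  by apply: emb_trans h; apply: sub_emb => x [Dx bx]; do !split=> //; exact: le_trans bx.
(* If no tail embeds in a proper initial segment, [d0] will do. Otherwise take a tail that embeds
   below the least possible [c]: a later tail squeezed below [c'] would, through [f], embed below
   [f c' < c]. *)
have [[c [b [Db h]]]|nh] := pselect (exists c b, D b /\ emb (D `&` tail b) (head c)).
- have {b Db h}[{}c [b [Db h]] cmin] := wo (ex_intro (fun c => exists b,
    D b /\ emb (D `&` tail b) (head c)) c (ex_intro _ b (conj Db h))).
  exists b => // b' c' Db' Dc' bb' bc' h'.
  have [f [fh fm]] := h.
  have : f c' < c by apply: fh.
  rewrite ltNge => /negP; apply; apply: cmin; exists b'; split=> //.
  apply: emb_trans h' _; exists f; split=> [x [[Dx bx] xc']|x y [xx _] [yy _]].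
    by apply: fm.
  exact: fm.
- exists d0 => // b c Db Dc _ _ h; apply: nh; exists c, b; split=> //.
  by apply: emb_subr h => x [].
Qed.


(** * Cofinal sequences of type omega and fusion of embeddings *)

Definition seg (t : nat -> alpha) n : set alpha := ival (t n) (t n.+1).

Definition ladder T (t : nat -> alpha) := [/\ forall x, T x -> t 0 <= x,
  forall n, T (t n), forall n, t n < t n.+1 & forall x, T x -> exists n, x < t n].

Definition nomax T := forall x, T x -> exists2 y, T y & x < y.

Lemma ladder_mono T t : ladder T t -> {homo t : m n / (m < n)%N >-> m < n}.
Proof. by case=> _ _ tS _; apply: homo_ltn => //; exact: lt_trans. Qed.

Lemma ladder_le T t m n : ladder T t -> (m <= n)%N -> t m <= t n.
Proof.
by move=> /ladder_mono tm; rewrite leq_eqVlt => /orP[/eqP->//|/tm/ltW].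
Qed.

Lemma ladder_seg T t x : ladder T t -> T x -> exists n, seg t n x.
Proof.
move=> [t0 _ _ cof] Tx; have ex := cof x Tx; case: (ex_minnP ex) => -[|n].
  by rewrite ltNge t0.
move=> xn nmin; exists n; split=> //; rewrite leNgt; apply/negP => /nmin.
by rewrite ltnn.
Qed.

Lemma ladder_seg_lt T t m n x y : ladder T t -> seg t m x -> seg t n y ->
  x < y -> (m <= n)%N.
Proof.
move=> tT [mx _] [_ yn] xy; rewrite leqNgt; apply/negP => nm.
have := le_lt_trans (le_trans (ladder_le tT nm) mx) xy.
by rewrite ltNge (ltW yn).
Qed.

(** Countability gives cofinality omega: each new term is taken above the next member of an
    enumeration of [T]. *)
Lemma ladder_ex T : countable T -> T !=set0 -> nomax T -> exists t, ladder T t.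
Proof.
move=> Tc T0 Tm; have [m Tm0 mmin] := wo T0.
have [e eP] : exists e : nat -> alpha, forall x, T x -> exists n, e n = x.
  have /countable_injP[f finj] := Tc.
  have /choice[e eP] : forall n, exists x, (exists2 y, T y & f y = n) -> T x /\ f x = n.
    move=> n; have [[y Ty fy]|h] := pselect (exists2 y, T y & f y = n).
      by exists y.
    by exists m => /h.
  exists e => x Tx; exists (f x); have [Te fe] := eP (f x) (ex_intro2 _ _ x Tx erefl).
  by apply: finj => //; rewrite inE.
have /choice[s sP] : forall xn : alpha * nat, exists y,
    T xn.1 -> [/\ T y, xn.1 < y & (T (e xn.2) -> e xn.2 < y)].
  move=> [x n] /=; have [Tx|] := pselect (T x); last by exists x.
  have [Te|nTe] := pselect (T (e n)); last first.
    by have [y Ty xy] := Tm x Tx; exists y.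
  have [xe|ex] := leP x (e n).
    have [y Ty ey] := Tm _ Te; exists y => _; split=> //; exact: le_lt_trans ey.
  have [y Ty xy] := Tm _ Tx; exists y => _; split=> // _; exact: lt_trans xy.
pose fix t n := if n is k.+1 then s (t k, k) else m.
have tT n : T (t n) by elim: n => //= n IH; have [] := sP (t n, n) IH.
exists t; split=> // [n|x Tx]; first by have [] := sP (t n, n) (tT n).
have [n en] := eP x Tx; exists n.+1; have [_ _] := sP (t n, n) (tT n).
by rewrite /= en; apply.
Qed.

(** The embeddings are used one on each segment; monotonicity across segments comes from the
    position of the targets. *)
Lemma glue T t (A : nat -> set alpha) : ladder T t ->
  (forall k, emb (T `&` seg t k) (A k)) ->
  (forall k l x y, (k < l)%N -> A k x -> A l y -> x < y) ->
  emb T (\bigcup_k A k).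
Proof.
move=> tT /choice[f fP] Alt.
have /choice[i iP] : forall x, exists n, T x -> seg t n x.
  move=> x; have [/(ladder_seg tT)[n]|] := pselect (T x); first by exists n.
  by exists 0%N.
exists (fun x => f (i x) x); split=> [x Tx|x y Tx Ty xy].
  by exists (i x) => //; apply: (fP (i x)).1; split=> //; exact: iP.
have [fx fy] := (iP x Tx, iP y Ty).
have := ladder_seg_lt tT fx fy xy; rewrite leq_eqVlt => /orP[/eqP e|il].
  by rewrite e in fx *; apply: (fP (i y)).2.
by apply: Alt il _ _; [apply: (fP (i x)).1|apply: (fP (i y)).1].
Qed.

(** Map [T] past [s] by indecomposability, then into [B]: a self-embedding moves no point down, so
    the image stays past [s], and the image of [t k.+1] bounds that of the segment. *)
Lemma seg_emb T t B s k : indec T -> ladder T t -> emb T (B `&` T) -> T s ->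
  exists s', [/\ T s', s < s' & emb (T `&` seg t k) (B `&` T `&` ival s s')].
Proof.
move=> Ti tT [f [fB fm]] Ts; have [g [gT gm]] := Ti s Ts.
have [_ tin tS _] := tT.
have gT1 x : T x -> T (g x) by move=> /gT[].
have hge x : T x -> s <= f (g x).
  move=> Tx; apply: le_trans (gT x Tx).2 _.
  by apply: (@self_emb_ge T f) => //; [move=> y /fB[]|exact: gT1].
have hm x y : T x -> T y -> x < y -> f (g x) < f (g y).
  by move=> Tx Ty xy; apply: fm; [exact: gT1|exact: gT1|exact: gm].
exists (f (g (t k.+1))); split.
- by have [] := fB _ (gT1 _ (tin k.+1)).
- by apply: le_lt_trans (hge _ (tin k)) _; exact: hm.
- exists (f \o g); split=> [x [Tx [kx xk]]|x y [Tx _] [Ty _]]; last exact: hm.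
  split; first exact: fB (gT1 _ Tx).
  by split; [exact: hge|exact: hm].
Qed.

(** Iterates [seg_emb], each stage starting where the previous one ended. The schedule [r] is [id]
    for fusion and [half], which copies each segment twice, for splitting. *)
Lemma spread T t (B : nat -> set alpha) (r : nat -> nat) :
  indec T -> ladder T t -> (forall k, emb T (B k `&` T)) ->
  exists s : nat -> alpha, (forall k, T (s k)) /\
    {homo s : m n / (m < n)%N >-> m < n} /\
    forall k, emb (T `&` seg t (r k)) (B k `&` T `&` seg s k).
Proof.
move=> Ti tT BT.
have /choice[F FP] : forall ks : nat * alpha, exists s', T ks.2 ->
    [/\ T s', ks.2 < s' & emb (T `&` seg t (r ks.1)) (B ks.1 `&` T `&` ival ks.2 s')].
  move=> [k s] /=; have [Ts|] := pselect (T s); last by exists s.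
  by have [s' h] := seg_emb (r k) Ti tT (BT k) Ts; exists s'.
have [_ /(_ 0%N) T0 _ _] := tT.
pose fix s n := if n is k.+1 then F (k, s k) else t 0%N.
have sT n : T (s n) by elim: n => //= n IH; have [] := FP (n, s n) IH.
exists s; split=> //; split=> [|k]; last by have [] := FP (k, s k) (sT k).
by apply: homo_ltn; [exact: lt_trans|move=> k; have [] := FP (k, s k) (sT k)].
Qed.

Lemma seg_disj (s : nat -> alpha) k l x y : {homo s : m n / (m < n)%N >-> m < n} ->
  (k < l)%N -> seg s k x -> seg s l y -> x < y.
Proof.
move=> sm kl [_ xk] [ly _]; apply: lt_le_trans xk (le_trans _ ly).
by move: kl; rewrite leq_eqVlt => /orP[/eqP->//|/sm/ltW].
Qed.

Lemma nomaxPn T : ~ nomax T -> exists2 m, T m & forall x, T x -> x <= m.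
Proof.
move=> /existsNP[m /not_implyP[Tm h]]; exists m => // x Tx.
by rewrite leNgt; apply/negP => mx; apply: h; exists x.
Qed.

(** Diagonal intersection: [B k] contributes only its part in [seg s k], which holds a copy of the
    [k]-th segment of [T]. Past [s n] the set [A] lies in [B n], and by indecomposability a positive
    [C] is still positive past [s n]. *)
Lemma indec_pinter T (B : nat -> set alpha) : countable T -> T !=set0 -> indec T ->
  (forall k, B k.+1 `<=` B k) -> (forall k, emb T (B k `&` T)) ->
  exists A, [/\ A `<=` T, emb T (A `&` T) &
    forall n C, emb T (C `&` T) -> C `<=` A -> emb T (C `&` B n `&` T)].
Proof.
move=> Tc T0 Ti BS BT.
have Ble m n : (m <= n)%N -> B n `<=` B m.
  elim: n => [|n IH]; first by rewrite leqn0 => /eqP->.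
  by rewrite leq_eqVlt ltnS => /orP[/eqP->//|/IH h] x /BS/h.
have [/(ladder_ex Tc T0)[t tT]|/nomaxPn[m Tm mmax]] := pselect (nomax T); last first.
  (* With a greatest point [m], a positive [D] must contain [m], and [T] embeds into its tail at
     [m], which is just [m]. *)
  have memm D : emb T (D `&` T) -> D m.
    move=> [f [fT fm]]; have [Dm Tfm] := fT m Tm.
    suff <- : f m = m by [].
    apply/eqP; rewrite eq_le mmax //=.
    by apply: (@self_emb_ge T f) => // x /fT[].
  exists T; split=> //; first by rewrite setIid; exact: emb_refl.
  move=> n C /memm Cm _; apply: emb_trans (Ti m Tm) _; apply: sub_emb => x [Tx mx].
  have -> : x = m by apply/eqP; rewrite eq_le mx mmax.
  by split=> //; split=> //; exact: memm.
have [s [sT [sm sP]]] := spread id Ti tT BT.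
exists (\bigcup_k (B k `&` T `&` seg s k)); split.
- by move=> x [k _ [[_ Tx] _]].
- apply: emb_subr (glue (A := fun k => B k `&` T `&` seg s k) tT sP _) => [x [k _ xk]|].
    by split; [exists k|case: xk => -[]].
  by move=> k l x y kl [_ xk] [_ yl]; exact: seg_disj kl xk yl.
- move=> n C [f [fC fm]] CA; have [g [gT gm]] := Ti (s n) (sT n).
  exists (f \o g); split=> [x Tx|x y Tx Ty xy]; last first.
    by apply: fm; [case: (gT x Tx)|case: (gT y Ty)|exact: gm].
  have [Tg sg] := gT x Tx; have [Cfg Tfg] := fC _ Tg.
  split=> //; split=> //=; have [k _ [[Bk _] [ks sk]]] := CA _ Cfg.
  apply: (Ble n k) => //; rewrite leqNgt; apply/negP => kn.
  have : g x <= f (g x) by apply: (@self_emb_ge T f) => // y /fC[].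
  move=> /(le_trans sg); rewrite leNgt => /negP; apply; apply: lt_le_trans sk _.
  by move: kn; rewrite leq_eqVlt => /orP[/eqP->//|/sm/ltW].
Qed.

(** Each segment is copied twice in succession; the even places form one half and the odd places the
    other. *)
Lemma indec_split T : countable T -> T !=set0 -> indec T -> nomax T ->
  exists J0 J1, [/\ J0 `<=` T, J1 `<=` T, J0 `&` J1 = set0, emb T J0 & emb T J1].
Proof.
move=> Tc T0 Ti /(ladder_ex Tc T0)[t tT].
have BT (k : nat) : emb T (setT `&` T) by rewrite setTI; exact: emb_refl.
have [s [sT [sm sP]]] := spread half Ti tT BT.
pose J (i : bool) := \bigcup_k (T `&` seg s (i + k.*2)%N).
have JT i : emb T (J i).
  apply: (glue tT) => [k|k l x y kl [_ xk] [_ yl]].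
    by have := sP (i + k.*2)%N; rewrite setTI half_bit_double.
  by apply: seg_disj xk yl => //; rewrite ltn_add2l ltn_double.
exists (J false), (J true); split=> //; [by move=> x [k _ []]|by move=> x [k _ []]|].
apply/seteqP; split=> // x [[k _ [_ xk]] [l _ [_ xl]]].
have := @ltngtP (false + k.*2) (true + l.*2).
case=> [h|h|e].
- by have := seg_disj sm h xk xl; rewrite ltxx.
- by have := seg_disj sm h xl xk; rewrite ltxx.
- by have := congr1 odd e; rewrite /= add0n odd_double oddD odd_double.
Qed.

(** * Cutting into indecomposable blocks *)

Definition downset D := forall x y, D y -> x <= y -> D x.

(* For [x] in the set [C] of cut points: the block of points that start at [x]
   and stop before the next cut point. *)
Definition blk C x : set alpha :=
  [set y | x <= y /\ forall z, C z -> z <= y -> z <= x].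

(** A form of the Cantor normal form: split off an indecomposable tail starting at [c] and recurse
    on the interval that ends at [c < b]. *)
Lemma indec_cuts a b : a < b -> exists C, [/\ finite_set C, C a, C `<=` ival a b &
  forall x, C x -> indec (ival a b `&` blk C x)].
Proof.
elim/wo_ind: b => b IH ab.
have [c [ac cb] ci] := @indec_tail (ival a b) (ex_intro _ a (conj (lexx a) ab)).
have [e|nac] := eqVneq a c.
  subst c; exists [set a]; split=> // [_ ->|_ ->]; first by split.
  apply: (eq_rect _ indec ci); apply/esym/seteqP; split=> y [yab]; first by case.
  by move=> ay; split=> //; split=> // z ->.
have {nac}ac' : a < c by rewrite lt_neqAle nac.
have [C [Cf Ca Cac Ci]] := IH c cb ac'.
exists (C `|` [set c]); split.
- by rewrite finite_setU.
- by left.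
- by move=> x [/Cac[ax xc]|->]; split=> //; exact: lt_trans cb.
- move=> x [Cx|->].
    have [ax xc] := Cac x Cx.
    apply: (eq_rect _ indec (Ci x Cx)); apply/esym/seteqP.
    split=> y [[ay yb] [xy ymax]]; split; split=> //.
    + rewrite ltNge; apply/negP => cy.
      by have := ymax c (or_intror erefl) cy; rewrite leNgt xc.
    + by move=> z Cz; apply: ymax; left.
    + exact: lt_trans cb.
    + move=> z [Cz|->]; first exact: ymax.
      by rewrite leNgt yb.
  apply: (eq_rect _ indec ci); apply/esym/seteqP; split=> y [yab]; first by case.
  move=> cy; split=> //; split=> // z [/Cac[_ /ltW]//|->//].
Qed.

(** Each interval of a ladder is cut into finitely many blocks. Only finitely many cut points lie
    below a point of [M], so the successive cut points form a cofinal sequence of type omega. *)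
Lemma block_ladder M : countable M -> M !=set0 -> nomax M -> downset M ->
  exists b : nat -> alpha, ladder M b /\ forall n, indec (seg b n).
Proof.
move=> Mc M0 Mm Md; have [t tM] := ladder_ex Mc M0 Mm.
have [tmin tin tS tcof] := tM.
have /choice[C CP] : forall k, exists C, [/\ finite_set C, C (t k), C `<=` seg t k &
    forall x, C x -> indec (seg t k `&` blk C x)].
  by move=> k; exact: indec_cuts.
pose K := \bigcup_k C k.
have KM x : K x -> M x.
  by move=> [k _ /(let: And4 _ _ h _ := CP k in h)[_ /ltW]]; exact: Md.
have Kfin x : M x -> finite_set (K `&` head x).
  move=> /tcof[n xn]; apply: (@sub_finite_set _ _ (\bigcup_(k < n) C k)).
    move=> y [[k _ Cy] yx]; exists k => //=.
    have [_ _ /(_ _ Cy)[ky _] _] := CP k.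
    rewrite ltnNge; apply/negP => /(ladder_le tM) nk.
    have := le_lt_trans (le_trans nk ky) yx.
    by rewrite ltNge (ltW xn).
  by apply: bigcup_finite => [|k _]; [exact: finite_II|have [] := CP k].
have Ki x : K x -> indec (blk K x `&` M).
  move=> [k _ Cx]; have [_ _ Csub /(_ _ Cx) iC] := CP k.
  have [kx xk] := Csub _ Cx.
  apply: (eq_rect _ indec iC); apply/esym/seteqP; split=> y.
    move=> [[xy ymax] My]; split; split=> //.
    - exact: le_trans xy.
    - rewrite ltNge; apply/negP => ky.
      have /ymax/(_ ky) : K (t k.+1) by exists k.+1 => //; have [] := CP k.+1.
      by rewrite leNgt xk.
    - by move=> z Cz; apply: ymax; exists k.
  move=> [[ky yk] [xy ymax]]; split; last by apply: Md (ltW yk).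
  split=> // z [j _ Cz] zy.
  have [_ _ /(_ _ Cz)[jz zj] _] := CP j.
  have : (j <= k)%N.
    rewrite leqNgt; apply/negP => /(ladder_le tM) kj.
    have := lt_le_trans yk (le_trans kj jz).
    by rewrite ltNge zy.
  rewrite leq_eqVlt => /orP[/eqP e|jk]; first by subst j; exact: ymax.
  by apply: (le_trans (ltW zj)); apply: le_trans kx; exact: (ladder_le tM jk).
have /choice[nx nxP] : forall x, exists y, M x ->
    [/\ K y, x < y & forall z, K z -> x < z -> y <= z].
  move=> x; have [/tcof[n xn]|] := pselect (M x); last by exists x.
  have : exists z, K z /\ x < z.
    by exists (t n); split=> //; exists n => //; have [] := CP n.
  by move=> /wo[y [Ky xy] ymin]; exists y => _; split=> // z Kz xz; exact: ymin.
pose b n := iter n nx (t 0%N).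
have bK n : K (b n).
  elim: n => [|n /KM/nxP[]//]; exists 0%N => //; by have [] := CP 0%N.
have bS n : b n < b n.+1 by have [] := nxP _ (KM _ (bK n)).
have bm : {homo b : m n / (m < n)%N >-> m < n}.
  by apply: homo_ltn => //; exact: lt_trans.
have bM : ladder M b.
  split=> // [n|x Mx]; first exact/KM/bK.
  apply: contrapT => /forallNP h; have [y My xy] := Mm x Mx.
  have : finite_set (b @^-1` (K `&` head y)).
    apply: finite_preimage (Kfin y My) => m n _ _ e.
    by case: (ltngtP m n) => // /bm; rewrite e ltxx.
  suff -> : b @^-1` (K `&` head y) = setT by exact: infinite_nat.
  apply/seteqP; split=> // n _; split; first exact: bK.
  by apply: le_lt_trans xy; rewrite leNgt; apply/negP; exact: h.
exists b; split=> // n.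
have [_ _ nmin] := nxP _ (KM _ (bK n)).
apply: (eq_rect _ indec (Ki _ (bK n))); apply/esym/seteqP; split=> y.
  move=> [ny yn]; split; last by apply: Md (ltW yn); exact/KM/(bK n.+1).
  split=> // z Kz zy; rewrite leNgt; apply/negP => nz.
  by have := nmin z Kz nz; rewrite leNgt (le_lt_trans zy yn).
move=> [[ny ymax] My]; split=> //; rewrite ltNge; apply/negP => yn.
by have := ymax _ (bK n.+1) yn; rewrite leNgt bS.
Qed.

(** * Positivity in [M] in terms of its blocks *)

Section Blocks.
Variables (M : set alpha) (b : nat -> alpha).
Hypotheses (Md : downset M) (Mi : indec M) (bM : ladder M b)
  (bi : forall n, indec (seg b n)).

Lemma seg_sub n : seg b n `<=` M.
Proof. by move=> x [_ /ltW]; apply: Md; have [] := bM. Qed.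

Lemma seg_uniq m n x : seg b m x -> seg b n x -> m = n.
Proof.
move=> xm xn; case: (ltngtP m n) => // h.
  by have := seg_disj (ladder_mono bM) h xm xn; rewrite ltxx.
by have := seg_disj (ladder_mono bM) h xn xm; rewrite ltxx.
Qed.

Lemma seg_start n : seg b n (b n).
Proof. by split=> //; have [] := bM. Qed.

(** Below [b L] there are finitely many blocks; [n] is the greatest index that the values of [h]
    reach. *)
Lemma seg_catch (h : alpha -> alpha) A L : A !=set0 ->
  (forall x y, A x -> A y -> x < y -> h x < h y) ->
  (forall x, A x -> M (h x)) -> (forall x, A x -> h x < b L) ->
  exists n, exists2 x, A x & forall y, A y -> x <= y -> seg b n (h y).
Proof.
move=> [a Aa] hm hM hL.
have [b0 _ _ _] := bM.
pose Q n := `[< exists2 x, A x & b n <= h x >].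
have Q0 : exists n, Q n by exists 0%N; apply/asboolP; exists a => //; apply/b0/hM.
have QL n : Q n -> (n <= L)%N.
  move=> /asboolP[x Ax nx]; rewrite leqNgt; apply/negP => /ltnW/(ladder_le bM) Ln.
  have := le_lt_trans (le_trans Ln nx) (hL x Ax).
  by rewrite ltxx.
case: (ex_maxnP Q0 QL) => n /asboolP[x Ax nx] nmax; exists n, x => // y Ay.
rewrite le_eqVlt => xy.
have hxy : h x <= h y by case/orP: xy => [/eqP->//|xy]; apply/ltW/hm.
split; first exact: le_trans hxy.
rewrite ltNge; apply/negP => yn.
have /nmax : Q n.+1 by apply/asboolP; exists y.
by rewrite ltnn.
Qed.

(** A bounded copy of the block may straddle several blocks, but a final part of it lies in a single
    one, and the block embeds into its own tail. *)
Lemma block_emb B k N : emb M (B `&` M) ->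
  exists2 n, (N <= n)%N & emb (seg b k) (B `&` seg b n).
Proof.
move=> BM; have [s [Ms Ns]] := seg_emb k Mi bM BM (let: And4 _ h _ _ := bM in h N).
move=> [h [hB hm]].
have [_ _ _ /(_ s Ms)[L sL]] := bM.
have hB' x : seg b k x -> (B `&` M `&` ival (b N) s) (h x).
  by move=> kx; apply: hB; split=> //; exact: seg_sub kx.
have hm' x y : seg b k x -> seg b k y -> x < y -> h x < h y.
  by move=> kx ky; apply: hm; split=> //; [exact: seg_sub kx|exact: seg_sub ky].
have [n [x kx xn]] : exists n, exists2 x, seg b k x &
    forall y, seg b k y -> x <= y -> seg b n (h y).
  apply: (@seg_catch h _ L) => //; first by exists (b k); exact: seg_start.
    by move=> x /hB'[[]].
  by move=> x /hB'[_ [_ xs]]; exact: lt_trans sL.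
exists n.
  rewrite leqNgt; apply/negP => /(ladder_le bM) nN.
  have [_ hxn] := xn x kx (lexx x).
  have [_ [Nh _]] := hB' x kx.
  by have := lt_le_trans hxn (le_trans nN Nh); rewrite ltxx.
apply: emb_trans (bi kx) _; exists h; split=> [y [ky xy]|y z [ky _] [kz _]].
  by split; [case: (hB' y ky) => -[]|exact: xn].
exact: hm'.
Qed.

(** Order types are comparable, so finitely many blocks have a largest one. *)
Lemma block_max k : exists m, forall j, (j <= k)%N -> emb (seg b j) (seg b m).
Proof.
elim: k => [|k [m mP]].
  by exists 0%N => j; rewrite leqn0 => /eqP->; exact: emb_refl.
have [h|h] := emb_total (seg b k.+1) (seg b m).
  by exists m => j; rewrite leq_eqVlt => /orP[/eqP->//|/mP].
exists k.+1 => j; rewrite leq_eqVlt => /orP[/eqP->|/mP jm]; first exact: emb_refl.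
exact: emb_trans h.
Qed.

Lemma blocks_emb B k N : emb M (B `&` M) -> exists2 n, (N <= n)%N &
  forall j, (j <= k)%N -> emb (seg b j) (B `&` seg b n).
Proof.
move=> BM; have [m mP] := block_max k; have [n Nn mn] := block_emb m N BM.
by exists n => // j /mP jm; exact: emb_trans mn.
Qed.

(** Converse to [blocks_emb]: copies lying in increasing blocks are glued along the ladder. *)
Lemma emb_blocks B (u : nat -> nat) : {homo u : m n / (m < n)%N} ->
  (forall k, emb (seg b k) (B `&` seg b (u k))) -> emb M (B `&` M).
Proof.
move=> um uP; apply: emb_subr (glue bM (A := fun k => B `&` seg b (u k)) _ _).
- by move=> x [k _ [Bx /seg_sub]].
- by move=> k; apply: emb_trans (uP k); apply: sub_emb => x [].
- move=> k l x y kl [_ xk] [_ yl].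
  by apply: seg_disj xk yl; [exact: ladder_mono bM|exact: um].
Qed.

End Blocks.

(** * The summands after the first *)

(** What is asked of positivity outside [M]: it is upward closed, depends only on the trace on [S],
    and has diagonal lower bounds of decreasing sequences. *)
Definition good S (Q : set alpha -> Prop) := [/\ Q S,
  forall A B, A `<=` B -> Q A -> Q B, forall A, Q A -> Q (A `&` S) &
  forall B : nat -> set alpha, (forall k, B k.+1 `<=` B k) -> (forall k, Q (B k)) ->
    exists A, [/\ A `<=` S, Q A & forall n C, Q C -> C `<=` A -> Q (C `&` B n)]].

(** Incompatibility replaces disjointness because, when a single summand is split, both parts keep
    all of [B] in the other summands. *)
Definition splits (Q : set alpha -> Prop) := forall B, Q B -> exists C C',
  [/\ C `<=` B, C' `<=` B, Q C, Q C' & ~ Q (C `&` C')].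

Lemma good_indec T : countable T -> T !=set0 -> indec T ->
  good T (fun B => emb T (B `&` T)).
Proof.
move=> Tc T0 Ti; split.
- by rewrite setIid; exact: emb_refl.
- by move=> A B AB; apply: emb_subr => x [/AB].
- by move=> A; rewrite -setIA setIid.
- by move=> B BS BT; have [A AP] := indec_pinter Tc T0 Ti BS BT; exists A.
Qed.

Lemma emb_split T A : countable T -> T !=set0 -> indec T -> nomax T -> emb T A ->
  exists D0 D1, [/\ D0 `<=` A, D1 `<=` A, D0 `&` D1 = set0, emb T D0 & emb T D1].
Proof.
move=> Tc T0 Ti Tm [f [fA fm]].
have [J0 [J1 [s0 s1 J01 e0 e1]]] := indec_split Tc T0 Ti Tm.
have eJ J : J `<=` T -> emb T J -> emb T (f @` J).
  move=> JT TJ; apply: emb_trans TJ _; exists f; split=> [x Jx|x y /JT Tx /JT].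
    by exists x.
  exact: fm.
exists (f @` J0), (f @` J1); split; [by move=> _ [x /s0/fA ? <-]|
  by move=> _ [x /s1/fA ? <-]| |exact: eJ|exact: eJ].
apply/seteqP; split=> // _ [[x Jx <-] [y Jy ey]].
suff xy : x = y by have : (J0 `&` J1) x by [split=> //; rewrite xy]; rewrite J01.
have := fm x y (s0 x Jx) (s1 y Jy); have := fm y x (s1 y Jy) (s0 x Jx).
rewrite ey ltxx => h1 h2; apply/eqP; rewrite eq_le !leNgt.
by apply/andP; split; apply/negP; auto.
Qed.

Lemma splits_indec T : countable T -> T !=set0 -> indec T -> nomax T ->
  splits (fun B => emb T (B `&` T)).
Proof.
move=> Tc T0 Ti Tm B /(emb_split Tc T0 Ti Tm)[C [C' [CB CB' CC' e e']]].
exists C, C'; split; [by move=> x /CB[]|by move=> x /CB'[]| | |].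
- by apply: emb_subr e => x Cx; split=> //; case: (CB x Cx).
- by apply: emb_subr e' => x Cx; split=> //; case: (CB' x Cx).
- by move=> [f [fC _]]; have [t /fC[]] := T0; rewrite CC'.
Qed.

Lemma good_prod S1 S2 Q1 Q2 : S1 `&` S2 = set0 -> good S1 Q1 -> good S2 Q2 ->
  good (S1 `|` S2) (fun B => Q1 B /\ Q2 B).
Proof.
move=> S12 [top1 up1 loc1 fus1] [top2 up2 loc2 fus2]; split.
- by split; [apply: up1 top1|apply: up2 top2] => x; [left|right].
- by move=> A B AB [/(up1 _ _ AB) ? /(up2 _ _ AB)].
- by move=> A [/loc1 h1 /loc2 h2]; split; [apply: up1 h1|apply: up2 h2] => x [];
    split=> //; [left|right].
- move=> B BS BQ.
  have [A1 [A1S QA1 A1P]] := fus1 B BS (fun k => (BQ k).1).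
  have [A2 [A2S QA2 A2P]] := fus2 B BS (fun k => (BQ k).2).
  have no x : S1 x -> S2 x -> False.
    by move=> h1 h2; have : (S1 `&` S2) x by []; rewrite S12.
  exists (A1 `|` A2); split.
  + by move=> x [/A1S|/A2S]; [left|right].
  + by split; [apply: up1 QA1|apply: up2 QA2] => x; [left|right].
  + move=> n C [/loc1 h1 /loc2 h2] CA; split.
      apply: up1 (A1P n _ h1 _) => [x [[]] //|x [/CA[//|/A2S xS2] xS1]].
      by case: (no x).
    apply: up2 (A2P n _ h2 _) => [x [[]] //|x [/CA[/A1S xS1|//] xS2]].
    by case: (no x).
Qed.

Lemma splits_prodl S1 S2 Q1 Q2 : S1 `&` S2 = set0 -> good S1 Q1 -> good S2 Q2 ->
  splits Q1 -> splits (fun B => Q1 B /\ Q2 B).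
Proof.
move=> S12 [_ up1 loc1 _] [_ up2 loc2 _] sp B [/sp[C [C' [CB CB' QC QC' nQ]]] Q2B].
have no x : S1 x -> S2 x -> False.
  by move=> h1 h2; have : (S1 `&` S2) x by []; rewrite S12.
exists (C `|` (B `&` S2)), (C' `|` (B `&` S2)); split.
- by move=> x [/CB|[]].
- by move=> x [/CB'|[]].
- by split; [apply: up1 QC|apply: up2 (loc2 _ Q2B)] => x; [left|right].
- by split; [apply: up1 QC'|apply: up2 (loc2 _ Q2B)] => x; [left|right].
- move=> [/loc1 h _]; apply: nQ; apply: up1 h => x [[[Cx|[_ x2]] [Cx'|[_ x2']]] x1] //;
  by case: (no x).
Qed.

Lemma splits_ext (Q Q' : set alpha -> Prop) : (forall B, Q B <-> Q' B) ->
  splits Q -> splits Q'.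
Proof.
move=> e sp B /e/sp[C [C' [CB CB' /e QC /e QC' nQ]]]; exists C, C'; split=> //.
by move/e.
Qed.

(** The tail at [m] is the single point [m], and an embedding into it leaves room for one point
    only. *)
Lemma indec_has_max T m : indec T -> T m -> (forall x, T x -> x <= m) ->
  T `<=` [set m].
Proof.
move=> Ti Tm mmax x Tx; have [f [fT fm]] := Ti m Tm.
have fE y : T y -> f y = m.
  by move=> /fT[/mmax Tf mf]; apply/eqP; rewrite eq_le Tf.
apply/eqP; rewrite eq_le mmax //= leNgt; apply/negP => xm.
by have := fm _ _ Tx Tm xm; rewrite !fE // ltxx.
Qed.

(* If a point below [a] were sent into the tail at [a], the tail at that point
   would embed into the tail at [a] and be indecomposable. *)
Lemma emb_cut D a B : downset D -> D a -> indec (D `&` tail a) ->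
  (forall c, D c -> c < a -> ~ indec (D `&` tail c)) ->
  emb D (B `&` D) <->
  emb (head a) (B `&` head a) /\ emb (D `&` tail a) (B `&` (D `&` tail a)).
Proof.
move=> Dd Da Ti amin; split; last first.
  move=> [[f [fB fm]] [g [gB gm]]].
  exists (fun x => if x < a then f x else g x); split=> [x Dx|x y Dx Dy xy].
    case: ltP => [xa|ax].
      by have [Bf fa] := fB x xa; split=> //; apply: Dd (ltW fa).
    by have [Bg []] := gB x (conj Dx ax).
  case: (ltP x a) (ltP y a) => [xa|ax] [ya|ay].
  - exact: fm.
  - by apply: lt_le_trans (proj2 (fB x xa)) _; have [_ []] := gB y (conj Dy ay).
  - by have := le_lt_trans ax (lt_trans xy ya); rewrite ltxx.
  - exact: gm.
move=> [f [fB fm]].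
have fge x : D x -> x <= f x.
  by apply: (@self_emb_ge D f) => // y /fB[].
split; last first.
  exists f; split=> [x [Dx ax]|x y [Dx _] [Dy _]]; last exact: fm.
  have [Bf Df] := fB x Dx; do 2!split=> //; exact: le_trans (fge x Dx).
have hD x : x < a -> D x by move=> /ltW; exact: Dd.
exists f; split=> [x xa|x y /hD Dx /hD]; last exact: fm.
split; first by case: (fB x (hD x xa)).
rewrite /head /= ltNge; apply/negP => afx; apply: (amin x (hD x xa) xa) => y [Dy xy].
have h : emb (D `&` tail x) (D `&` tail a).
  exists f; split=> [z [Dz xz]|z w [Dz _] [Dw _]]; last exact: fm.
  split; first by case: (fB z Dz).
  apply: le_trans afx _; move: xz; rewrite /tail /= le_eqVlt => /orP[/eqP->//|xz].
  by apply/ltW/fm => //; exact: hD.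
apply: emb_trans h _.
have [ya|ay] := ltP y a.
  apply: sub_emb => z [Dz az]; split; [split=> //|].
    exact: le_trans (ltW xa) az.
  exact: le_trans (ltW ya) az.
apply: emb_trans (Ti y (conj Dy ay)) _; apply: sub_emb => z [[Dz az] yz].
by split=> //; split=> //; exact: le_trans (ltW xa) az.
Qed.

(* [M] is the first indecomposable summand of [D]; [Q] requires each of the later
   summands to embed into its own part of the set. *)
Definition decomposed D := exists M Q, [/\ M `<=` D, M !=set0, downset M, indec M &
  [/\ good (D `\` M) Q, forall B, emb D (B `&` D) <-> emb M (B `&` M) /\ Q B &
      splits Q \/ finite_set (D `\` M)]].

(** The least [a] with an indecomposable tail starts the last summand [T]. By [emb_cut] positivity
    splits into positivity in [head a], left to the induction, and in [T]; if [head a] is empty, [D]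
    is itself the first summand. *)
Lemma decomposed_step D : countable D -> D !=set0 -> downset D ->
  (forall a, D a -> head a !=set0 -> decomposed (head a)) -> decomposed D.
Proof.
move=> Dc D0 Dd IH.
have [a [Da Ti] amin] : exists2 a, D a /\ indec (D `&` tail a) &
    forall c, D c /\ indec (D `&` tail c) -> a <= c.
  by apply: wo; have [a Da Ti] := indec_tail D0; exists a.
have amin' c : D c -> c < a -> ~ indec (D `&` tail c).
  by move=> Dc' ca ci; have := amin c (conj Dc' ci); rewrite leNgt ca.
have [h0|nh0] := pselect (head a !=set0); last first.
  have DE : D `&` tail a = D.
    apply/seteqP; split=> [x []//|x Dx]; split=> //.
    by rewrite /tail /= leNgt; apply/negP => xa; apply: nh0; exists x.
  exists D, (fun=> True); split=> //; first by rewrite -DE.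
  rewrite setDv; split; [split=> // B _ _; exists set0; split=> //|by move=> B; split=> [|[]]|].
  by right; exact: finite_set0.
have [M [Q [Mh M0 Md Mi [Qg MQ Qs]]]] := IH a Da h0.
pose T := D `&` tail a.
have DM : (head a `\` M) `|` T = D `\` M.
  apply/seteqP; split=> x.
    move=> [[xa nM]|[Dx ax]]; first by split=> //; exact: Dd (ltW xa).
    by split=> // /Mh; rewrite /head /= ltNge ax.
  move=> [Dx nM]; have [xa|ax] := ltP x a; [by left|by right].
have disj : (head a `\` M) `&` T = set0.
  apply/seteqP; split=> // x [[xa _] [_ ax]].
  by have := le_lt_trans ax xa; rewrite ltxx.
have T0 : T !=set0 by exists a; split=> //; exact: lexx.
have Tc : countable T by apply: sub_countable Dc; apply: subset_card_le => x [].
have Tg := good_indec Tc T0 Ti.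
exists M, (fun B => Q B /\ emb T (B `&` T)); split=> //.
  by move=> x /Mh xa; exact: Dd (ltW xa).
split; first by rewrite -DM; exact: good_prod.
  move=> B; split.
    by move=> /(emb_cut B Dd Da Ti amin')[/MQ[]].
  by move=> [MB [QB TB]]; apply/(emb_cut B Dd Da Ti amin'); split=> //; apply/MQ.
(* A summand without greatest point can be split; one with a greatest point is a singleton and keeps
   the remainder finite. *)
have [Tm|/nomaxPn[m Tm mmax]] := pselect (nomax T).
  left; rewrite setIC in disj.
  apply: splits_ext (splits_prodl disj Tg Qg (splits_indec Tc T0 Ti Tm)) => B.
  by split=> -[].
case: Qs => [Qs|Qf]; first by left; exact: splits_prodl disj Qg Tg Qs.
right; rewrite -DM finite_setU; split=> //.
apply: (@sub_finite_set _ _ [set m]) => //; exact: indec_has_max.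
Qed.

Lemma decomposedT : countable [set: alpha] -> [set: alpha] !=set0 ->
  decomposed [set: alpha].
Proof.
move=> ac a0.
have cD D : countable D by apply: sub_countable ac; apply: subset_card_le.
have IH : forall a, head a !=set0 -> decomposed (head a).
  apply: wo_ind => a IH h0; apply: decomposed_step => // x y ya xy.
  exact: le_lt_trans ya.
by apply: decomposed_step => // a _; exact: IH.
Qed.

(* [X] forces that [B] lies in the quotient: no [Y] below [X] forces it out. *)
Definition red (pos : set alpha -> Prop) (U : set nat -> set alpha) X B :=
  forall Y : set nat, Y `<=` X -> infinite_set Y -> pos (B `&` U Y).

(* The sets [U X] embed P(omega)/Fin into the positive sets; the fields are what
   makes the quotient of the positive sets by the generic filter of P(omega)/Fin
   a separative ([fib_red]), omega1-closed ([fib_fusion]) and atomless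
   ([fib_split]) forcing. *)
Record fibered (pos : set alpha -> Prop) (U : set nat -> set alpha) : Prop := {
  fib_up : forall A B, A `<=` B -> pos A -> pos B;
  fib_setI : forall X Y, U (X `&` Y) = U X `&` U Y;
  fib_pos : forall X, infinite_set X -> pos (U X);
  fib_inf : forall X, pos (U X) -> infinite_set X;
  fib_red : forall B, pos B -> exists2 X, infinite_set X & red pos U X B;
  fib_fusion : forall X (B : nat -> set alpha), infinite_set X ->
    (forall k, B k.+1 `<=` B k) -> (forall k, red pos U X (B k)) ->
    exists X' A, [/\ infinite_set X', X' `<=` X, red pos U X' A &
      forall k C, C `<=` A -> pos C -> pos (C `&` B k)];
  fib_split : forall X B, infinite_set X -> red pos U X B ->
    exists X' C C', [/\ infinite_set X', X' `<=` X,
      C `<=` B /\ C' `<=` B, red pos U X' C /\ red pos U X' C' & ~ pos (C `&` C')] }.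

Lemma infinite_natP (X : set nat) :
  infinite_set X <-> forall N, exists2 m, (N <= m)%N & X m.
Proof.
split=> [Xinf N|XN Xfin].
  apply: contrapT => h; apply: Xinf; apply: (@sub_finite_set _ _ `I_N).
    by move=> m Xm; rewrite /= ltnNge; apply/negP => Nm; apply: h; exists m.
  exact: finite_II.
have [u [um uX]] := @increasing_choice (fun _ m => X m) (fun _ => XN).
have : finite_set (u @^-1` X).
  apply: finite_preimage => // m n _ _ e.
  by case: (ltngtP m n) => // /um; rewrite e ltnn.
suff -> : u @^-1` X = setT by exact: infinite_nat.
by apply/seteqP; split=> // n _; exact: uX.
Qed.

Lemma homo_ltn_le (u : nat -> nat) : {homo u : m n / (m < n)%N} ->
  forall m n, (u m <= u n)%N -> (m <= n)%N.
Proof.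
by move=> um m n mn; rewrite leqNgt; apply/negP => /um; rewrite ltnNge mn.
Qed.

Lemma homo_ltn_range (u : nat -> nat) : {homo u : m n / (m < n)%N} ->
  infinite_set (range u).
Proof.
move=> um; apply/infinite_natP => N; exists (u N); last by exists N.
by elim: N => // N IH; apply: leq_ltn_trans IH _; exact: um.
Qed.

(** * Embedding P(omega)/Fin into the positive sets *)

Section Fibration.
Variables (M : set alpha) (b : nat -> alpha) (Q : set alpha -> Prop) (S : set alpha).
Hypotheses (countable_alpha : countable [set: alpha])
  (Md : downset M) (Mi : indec M) (bM : ladder M b) (bi : forall n, indec (seg b n))
  (Qg : good S Q) (SM : S = ~` M)
  (Qs : splits Q \/ exists k, nomax (seg b k)).

Let pos B := emb M (B `&` M) /\ Q B.

(* A single block may be too small for the union of infinitely many blocks to be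
   positive, as the isomorphism types of the blocks need not be nondecreasing:
   [g] merges consecutive blocks so that the k-th group embeds the first k blocks. *)
Lemma coarse_ex : exists g : nat -> nat, [/\ {homo g : m n / (m <= n)%N},
  forall N, exists L, forall n, (L <= n)%N -> (N <= g n)%N &
  forall k, exists2 n, g n = k & forall j, (j <= k)%N -> emb (seg b j) (seg b n)].
Proof.
have [u [um uP]] : exists u : nat -> nat, {homo u : m n / (m < n)%N} /\
    forall k j, (j <= k)%N -> emb (seg b j) (seg b (u k)).
  apply: (increasing_choice (R := fun k n =>
    forall j, (j <= k)%N -> emb (seg b j) (seg b n))) => k N.
  have MT : emb M (setT `&` M) by rewrite setTI; exact: emb_refl.
  have [n Nn nP] := blocks_emb Md Mi bM bi k N MT.
  by exists n => // j /nP; rewrite setTI.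
have uge n : (n <= u n)%N.
  by elim: n => // n IH; apply: leq_ltn_trans IH _; exact: um.
have ex n : exists k, (n <= u k)%N by exists n.
(* Block [n] joins the first group [k] with [n <= u k], so group [k] ends with block [u k], which
   embeds all blocks up to [k]. *)
pose g n := ex_minn (ex n).
have gle n k : (n <= u k)%N -> (g n <= k)%N by rewrite /g; case: ex_minnP => m _; apply.
have gP n : (n <= u (g n))%N by rewrite /g; case: ex_minnP.
exists g; split=> [m n mn|N|k].
- by apply: gle; apply: leq_trans mn (gP n).
- exists (u N) => n Nn; apply: (homo_ltn_le um); exact: leq_trans Nn (gP n).
- exists (u k); last exact: uP.
  by apply/eqP; rewrite eqn_leq gle //= (homo_ltn_le um).
Qed.

Section Coarse.
Variable g : nat -> nat.
Hypotheses (g_mono : {homo g : m n / (m <= n)%N})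
  (g_unb : forall N, exists L, forall n, (L <= n)%N -> (N <= g n)%N)
  (g_full : forall k, exists2 n, g n = k &
     forall j, (j <= k)%N -> emb (seg b j) (seg b n)).

(** The implication puts the whole complement of [M] into every [U X]. *)
Let U (X : set nat) : set alpha := [set x | M x -> exists2 n, X (g n) & seg b n x].

(** By [emb_large] and [large_emb], [B] is positive in [M] exactly when, for every [j], this holds
    at infinitely many groups [m]. *)
Let large j m B := exists2 n, g n = m & emb (seg b j) (B `&` seg b n).

Let large_sub j m A B : (forall n, g n = m -> A `&` seg b n `<=` B) ->
  large j m A -> large j m B.
Proof.
move=> AB [n gn h]; exists n => //; apply: emb_subr h => x [Ax xn].
by split=> //; exact: (AB n gn).
Qed.

Let large_U j m X B : large j m (B `&` U X) -> X m.
Proof.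
move=> [n <- [f [fB _]]]; have [[_ Uf] nf] := fB (b j) (seg_start bM j).
have [n' Xn' nf'] := Uf (seg_sub Md bM nf).
by rewrite (seg_uniq bM nf nf').
Qed.

Let U_large j m X B : X m -> large j m B -> large j m (B `&` U X).
Proof.
move=> Xm; apply: large_sub => n gn x [Bx nx]; split=> // _.
by exists n => //; rewrite gn.
Qed.

Let emb_large B k N : emb M (B `&` M) ->
  exists2 m, (N <= m)%N & forall j, (j <= k)%N -> large j m B.
Proof.
move=> BM; have [L LP] := g_unb N; have [n Ln nP] := blocks_emb Md Mi bM bi k L BM.
by exists (g n); [exact: LP|move=> j /nP; exists n].
Qed.

Let large_emb B : (forall k N, exists2 m, (N <= m)%N & large k m B) -> emb M (B `&` M).
Proof.
move=> /increasing_choice[u [um uP]].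
have /choice[n nP] k : exists n, g n = u k /\ emb (seg b k) (B `&` seg b n).
  by have [n] := uP k; exists n.
have gn k : g (n k) = u k by have [] := nP k.
apply: (emb_blocks Md bM (u := n)) => [k l kl|k]; last by have [] := nP k.
rewrite ltnNge; apply/negP => /g_mono; rewrite !gn.
by move=> /(homo_ltn_le um); rewrite leqNgt kl.
Qed.

Let Q_local A B : A `&` S `<=` B -> Q A -> Q B.
Proof. by have [_ up loc _] := Qg => AB /loc; exact: up. Qed.

(** Group [u k] serves all [j <= k], so any infinitely many of these groups serve every [j]:
    thinning the range does no harm. *)
Let red_range u B : {homo u : m n / (m < n)%N} ->
  (forall k j, (j <= k)%N -> large j (u k) B) -> Q B -> red pos U (range u) B.
Proof.
move=> um uB QB Y Yu /infinite_natP Yinf; split; last first.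
  by apply: Q_local QB => x [Bx]; rewrite SM => nMx; split=> // /nMx.
apply: large_emb => k N; have [m Nm Ym] := Yinf (maxn N (u k)).
exists m; first exact: leq_trans (leq_maxl _ _) Nm.
apply: U_large => //; have [l _ e] := Yu m Ym; rewrite -e; apply: uB.
by apply: (homo_ltn_le um); rewrite e; exact: leq_trans (leq_maxr _ _) Nm.
Qed.

Let pos_setT : pos setT.
Proof.
split; first by rewrite setTI; exact: emb_refl.
by have [QS up _ _] := Qg; apply: up QS.
Qed.

Lemma fibered_coarse : fibered pos U.
Proof.
have up A B : A `<=` B -> pos A -> pos B.
  move=> AB [MA QA]; split; first by apply: emb_subr MA => x [/AB].
  by apply: Q_local QA => x [/AB].
have Umono X Y : X `<=` Y -> U X `<=` U Y.
  by move=> XY x Ux Mx; have [n Xn nx] := Ux Mx; exists n => //; exact: XY.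
split=> //.
- move=> X Y; apply/seteqP; split=> [x Ux|x [UX UY] Mx].
    by split; apply: Umono Ux => n [].
  have [n Xn nx] := UX Mx; have [n' Yn' nx'] := UY Mx.
  by exists n => //; split=> //; rewrite (seg_uniq bM nx nx').
- move=> X Xinf; rewrite -[U X]setTI; suff /(_ X) : red pos U (range id) setT.
    by apply=> // m _; exists m.
  apply: red_range => // [k j jk|]; last by case: pos_setT.
  by have [n gn nP] := g_full k; exists n => //; rewrite setTI; exact: nP.
- move=> X [MX _]; apply/infinite_natP => N.
  have [m Nm /(_ 0%N isT) h] := emb_large 0 N MX; exists m => //.
  by move: h; rewrite -[U X]setTI; exact: large_U.
- move=> B [MB QB]; have [u [um uP]] := increasing_choice (R := fun k m =>
    forall j, (j <= k)%N -> large j m B) (fun k N => emb_large k N MB).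
  by exists (range u); [exact: homo_ltn_range|exact: red_range].
- move=> X B Xinf BS Bred.
  have Ble m n : (m <= n)%N -> B n `<=` B m.
    elim: n => [|n IH]; first by rewrite leqn0 => /eqP->.
    by rewrite leq_eqVlt ltnS => /orP[/eqP->//|/IH h] x /BS/h.
  have Bpos k : pos (B k `&` U X) by apply: Bred.
  have [u [um uP]] : exists u : nat -> nat, {homo u : m n / (m < n)%N} /\
      forall k, X (u k) /\ forall j, (j <= k)%N -> large j (u k) (B k).
    apply: (increasing_choice (R := fun k m =>
      X m /\ forall j, (j <= k)%N -> large j m (B k))) => k N.
    have [m Nm mP] := emb_large k N (Bpos k).1; exists m => //.
    split; first exact: (large_U (mP 0%N isT)).
    by move=> j /mP; apply: large_sub => n _ x [[]].
  have QB k : Q (B k) by apply: Q_local (Bpos k).2 => x [[]].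
  have [QS _ _ fus] := Qg; have [A [AS QA AP]] := fus B BS QB.
  (* Outside [M] the fusion provided by [Q]; inside [M], the set [B k] on group [u k]. *)
  pose A' := A `|` [set x | exists k n, [/\ B k x, g n = u k & seg b n x]].
  exists (range u), A'; split; [exact: homo_ltn_range|by move=> _ [k _ <-]; case: (uP k)| |].
    apply: red_range => // [k j jk|]; last by apply: Q_local QA => x [Ax _]; left.
    have [_ /(_ j jk)] := uP k; apply: large_sub => n gn x [Bx nx].
    by right; exists k, n.
  move=> k C CA [MC QC]; split.
    apply: large_emb => j N.
    (* From group [u k] on, a point of [A'] in [M] comes from some [B l] with [k <= l], hence lies
       in [B k]. *)
    have [m + /(_ j (leqnn j))] := emb_large j (maxn N (u k)) MC.
    rewrite geq_max => /andP[Nm km] Cm; exists m => //.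
    apply: large_sub Cm => n gn x [Cx nx]; split=> //.
    have Mx := seg_sub Md bM nx.
    have [/AS|[l [n' [Bx gn' nx']]]] := CA x Cx; first by rewrite SM => /(_ Mx).
    apply: (Ble k l) => //; apply: (homo_ltn_le um).
    by rewrite -gn' -(seg_uniq bM nx nx') gn.
  have QCS : Q (C `&` S) by apply: Q_local QC.
  apply: Q_local (AP k _ QCS _) => [x [[[Cx _] Bx] _]//|x [Cx xS]].
  have [//|[l [n [_ _ /(seg_sub Md bM)]]]] := CA x Cx.
  by move: xS; rewrite SM => h /h.
- move=> X B Xinf Bred.
  have [MBX QBX] : pos (B `&` U X) by exact: Bred.
  have QB : Q B by apply: Q_local QBX => x [[]].
  have MB : emb M (B `&` M) by apply: emb_subr MBX => x [[]].
  case: Qs => [sp|[k0 nk0]].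
    (* Split outside [M] only: both parts keep all of [B] in [M]. *)
    have [C [C' [CB CB' QC QC' nQ]]] := sp B QB.
    have CC D : Q D -> D `<=` B -> red pos U X ((B `&` M) `|` (D `&` S)).
      move=> QD DB Y YX Yinf; have [MBY QBY] := Bred Y YX Yinf; split.
        by apply: emb_subr MBY => x [[Bx Ux] Mx]; split=> //; split=> //; left.
      apply: Q_local QD => x [Dx Sx]; split; first by right.
      by move: Sx; rewrite SM => nM /nM.
    exists X, ((B `&` M) `|` (C `&` S)), ((B `&` M) `|` (C' `&` S)); split=> //.
    + by split=> x [[]//|[]]; [move=> /CB|move=> /CB'].
    + by split; exact: CC.
    + move=> [_ h]; apply: nQ; apply: Q_local h => x [[h1 h2]]; rewrite SM => nM.
      by split; [case: h1|case: h2] => -[].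
  (* Split inside [M]: [z] records a block of group [u k] and two disjoint parts of [B] in it, each
     embedding all blocks up to [k]. *)
  have [u [um uP]] : exists u : nat -> nat, {homo u : m n / (m < n)%N} /\
      forall k, X (u k) /\ exists z : nat * set alpha * set alpha,
        [/\ g z.1.1 = u k, z.1.2 `<=` B `&` seg b z.1.1, z.2 `<=` B `&` seg b z.1.1,
            z.1.2 `&` z.2 = set0 &
          forall j, (j <= k)%N -> emb (seg b j) z.1.2 /\ emb (seg b j) z.2].
    apply: (increasing_choice (R := fun k m => X m /\ exists z : nat * set alpha * set alpha,
        [/\ g z.1.1 = m, z.1.2 `<=` B `&` seg b z.1.1, z.2 `<=` B `&` seg b z.1.1,
            z.1.2 `&` z.2 = set0 &
          forall j, (j <= k)%N -> emb (seg b j) z.1.2 /\ emb (seg b j) z.2])) => k N.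
    (* Block [k0], which has no greatest point, embeds into block [i]; so block [i] is not a
       singleton, has no greatest point, and its copy in [B] can be split. *)
    have [i iP] := block_max b (maxn k k0).
    have ni : nomax (seg b i).
      apply: contrapT => /nomaxPn[m im mmax].
      have sm := indec_has_max (@bi i) im mmax.
      have [f [fi fm]] := iP k0 (leq_maxr _ _).
      have [y k0y by_] := nk0 _ (seg_start bM k0).
      have := fm _ _ (seg_start bM k0) k0y by_.
      by rewrite (sm _ (fi _ (seg_start bM k0))) (sm _ (fi _ k0y)) ltxx.
    have [L LP] := g_unb N.
    have [n Ln iB] := block_emb Md Mi bM bi i L MBX.
    have c : countable (seg b i).
      by apply: sub_countable countable_alpha; apply: subset_card_le.
    have [D0 [D1 [s0 s1 D01 e0 e1]]] :=
      emb_split c (ex_intro _ _ (seg_start bM i)) (@bi i) ni iB.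
    exists (g n); first exact: LP.
    split; first by apply: (@large_U i _ X B); exists n.
    exists (n, D0, D1); split=> //= [x /s0[[]]//|x /s1[[]]//|j jk].
    have ji := iP j (leq_trans jk (leq_maxl _ _)).
    by split; [exact: emb_trans ji e0|exact: emb_trans ji e1].
  have /choice[z zP] := fun k => (uP k).2.
  pose E (D : nat -> set alpha) := (B `&` S) `|` \bigcup_k D k.
  have ED (D : nat -> set alpha) : (forall k, D k `<=` B `&` seg b (z k).1.1) ->
      (forall k j, (j <= k)%N -> emb (seg b j) (D k)) -> red pos U (range u) (E D).
    move=> DB De; apply: red_range => // [k j jk|]; last first.
      by apply: Q_local QB => x BSx; left.
    exists (z k).1.1; first by have [] := zP k.
    apply: emb_subr (De k j jk) => x Dx; split; last by case: (DB k x Dx).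
    by right; exists k.
  exists (range u), (E (fun k => (z k).1.2)), (E (fun k => (z k).2)); split.
  + exact: homo_ltn_range.
  + by move=> _ [k _ <-]; case: (uP k).
  + split=> x [[]//|[k _]]; have [_ s0 s1 _ _] := zP k; first by move=> /s0[].
    by move=> /s1[].
  + split; apply: ED => k; have [_ s0 s1 _ e] := zP k => // j /e[] //.
  (* A common point in [M] would lie in one block, hence in both parts for the same [k], but these
     are disjoint. *)
  + move=> [[f [fE _]] _].
    have [_ /(_ 0%N) M0 _ _] := bM.
    have [[E0 E1] Mf] := fE _ M0.
    have nS : ~ S (f (b 0%N)) by rewrite SM => /(_ Mf).
    case: E0 => [[_ /nS]//|[k _ D0]]; case: E1 => [[_ /nS]//|[l _ D1]].
    have [gk s0 _ D01 _] := zP k; have [gl _ s1 _ _] := zP l.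
    have [_ kf] := s0 _ D0; have [_ lf] := s1 _ D1.
    have ukl : u k = u l by rewrite -gk -gl (seg_uniq bM kf lf).
    have kl : k = l.
      by apply/eqP; rewrite eqn_leq; apply/andP; split; apply: (homo_ltn_le um);
        rewrite ukl.
    by move: D1; rewrite -kl => D1; have : ((z k).1.2 `&` (z k).2) (f (b 0%N)) by []; rewrite D01.
Qed.

End Coarse.

End Fibration.

(* [e] and [w] enumerate the two copies of omega in the initial segment omega + omega. *)
Section OmegaPlusOmega.
Variables (e w : nat -> alpha).
Hypotheses (countable_alpha : countable [set: alpha])
  (e_mono : {homo e : m n / (m < n)%N >-> m < n})
  (w_mono : {homo w : m n / (m < n)%N >-> m < n})
  (ew : forall n, e n < w 0%N)
  (e_init : forall n x, x <= e n -> exists m, e m = x).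

(** Shifting the first copy of omega by one and fixing all else omits the least point. This keeps
    the first summand from being a singleton. *)
Lemma emb_shift m : (forall x, m <= x) -> emb setT [set x | x != m].
Proof.
move=> m_min; pose in_e x := exists n, e n = x.
have /choice[s sP] : forall x, exists y,
    (forall n, e n = x -> y = e n.+1) /\ (~ in_e x -> y = x).
  move=> x; have [[n <-]|nx] := pselect (in_e x); last first.
    by exists x; split=> // n ex; case: nx; exists n.
  exists (e n.+1); split=> [k ekn|[]]; last by exists n.
  by case: (ltngtP k n) => [/e_mono|/e_mono|->//]; rewrite ekn ltxx.
have se n : s (e n) = e n.+1 by apply: (sP (e n)).1.
have sn x : ~ in_e x -> s x = x by exact: (sP x).2.
exists s; split=> [x _|x y _ _ xy].
  have [[n <-]|nx] := pselect (in_e x).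
    by rewrite se /= gt_eqF //; apply: le_lt_trans (m_min (e n)) _; exact: e_mono.
  rewrite (sn x nx) /=; apply/eqP => xm; apply: nx; apply: (e_init (n := 0%N)).
  by rewrite xm m_min.
have [[n ey]|ny] := pselect (in_e y).
  have [k ek] : in_e x by apply: (e_init (n := n)); rewrite ey ltW.
  rewrite -ey -ek !se; apply: e_mono; rewrite ltnS.
  case: (ltngtP k n) => // [/e_mono|kn].
    by rewrite ek ey ltNge (ltW xy).
  by move: xy; rewrite -ey -ek kn ltxx.
rewrite (sn y ny); have [[n ex]|nx] := pselect (in_e x); last by rewrite sn.
rewrite -ex se ltNge; apply/negP => /e_init; exact: ny.
Qed.

Theorem fibered_copies : exists U, fibered (fun B => emb setT B) U.
Proof.
have [M [Q [_ M0 Md Mi [Qg MQ Qs]]]] :=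
  decomposedT countable_alpha (ex_intro _ (w 0%N) I).
have Mc : countable M by apply: sub_countable countable_alpha; apply: subset_card_le.
have Mn : nomax M.
  apply: contrapT => /nomaxPn[m Mm mmax]; have Mm' := indec_has_max Mi Mm mmax.
  have m_min x : m <= x.
    rewrite leNgt; apply/negP => xm; have Mx := Md _ _ Mm (ltW xm).
    by move: xm; rewrite (Mm' x Mx) ltxx.
  have : emb setT ([set x | x != m] `&` setT) by rewrite setIT; exact: emb_shift.
  move=> /MQ[[f [fM _]] _]; have [] := fM m Mm.
  by move=> /eqP nm /Mm'.
have [b [bM bi]] := block_ladder Mc M0 Mn Md.
have Qs' : splits Q \/ exists k, nomax (seg b k).
  case: Qs => [|Mf]; [by left|right].
  (* A finite complement of [M] cannot contain the second copy of omega, so [w 0] is in [M]. The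
     first copy is then bounded in [M], and a final part of it lies in one block, which has no
     greatest point. *)
  have Mw : M (w 0%N).
    apply: contrapT => nM0; have : finite_set (w @^-1` (setT `\` M)).
      apply: finite_preimage Mf => m n _ _ wmn.
      by case: (ltngtP m n) => // /w_mono; rewrite wmn ltxx.
    suff -> : w @^-1` (setT `\` M) = setT by exact: infinite_nat.
    apply/seteqP; split=> // n _; split=> // Mwn; apply: nM0.
    by apply: Md Mwn _; case: n => // n; apply/ltW/w_mono.
  have [_ _ _ /(_ _ Mw)[L wL]] := bM.
  have [n [x [i _ <-] xn]] : exists n, exists2 x, range e x &
      forall y, range e y -> x <= y -> seg b n y.
    apply: (seg_catch bM (h := id) (L := L)) => //; first by exists (e 0%N), 0%N.
    - by move=> _ [i _ <-]; apply: Md Mw _; exact/ltW/ew.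
    - by move=> _ [i _ <-]; exact: lt_trans (ew i) wL.
  exists n; apply: contrapT => /nomaxPn[m nm mmax].
  have h := indec_has_max (@bi n) nm mmax.
  have ii : e i < e i.+1 by exact: e_mono.
  have e1 := h _ (xn (e i) (ex_intro2 _ _ i I erefl) (lexx _)).
  have e2 := h _ (xn (e i.+1) (ex_intro2 _ _ i.+1 I erefl) (ltW ii)).
  by move: ii; rewrite e1 e2 ltxx.
have [g [g_mono g_unb g_full]] := coarse_ex Md Mi bM bi.
have SM : setT `\` M = ~` M by rewrite setTD.
have := fibered_coarse countable_alpha Md Mi bM bi Qg SM Qs' g_mono g_unb g_full.
suff <- : (fun B => emb setT B) = (fun B => emb M (B `&` M) /\ Q B).
  by move=> fU; eexists; exact: fU.
by apply: funext => B; apply: propext; rewrite -MQ setIT.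
Qed.

End OmegaPlusOmega.
End WellOrder.

(** * The quotient of the positive sets by P(omega)/Fin *)

Definition rep (x : PomegaFin_pos) : set nat := repr (val x).

Lemma PomegaFin_leE (x y : PomegaFin_pos) :
  (x <= y)%O <-> finite_set (rep x `\` rep y).
Proof. by split=> [/asboolP|?]; last apply/asboolP. Qed.

Lemma rep_infinite x : infinite_set (rep x).
Proof.
move=> xfin; have /negP := valP x; apply; apply/eqP.
rewrite -[val x]reprK; apply/eqmodP/asboolP; rewrite setD0; split=> //.
by rewrite set0D; exact: finite_set0.
Qed.

Lemma PomegaFin_class (X : set nat) : infinite_set X -> exists x : PomegaFin_pos,
  finite_set (rep x `\` X) /\ finite_set (X `\` rep x).
Proof.
move=> Xinf; have nz : \pi_PomegaFin X != \pi_PomegaFin set0.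
  apply/negP => /eqP/eqmodP/asboolP[]; by rewrite setD0.
exists (exist _ (\pi_PomegaFin X) nz); rewrite /rep /=.
have : \pi_PomegaFin (repr (\pi_PomegaFin X)) = \pi_PomegaFin X by rewrite reprK.
by move=> /eqmodP/asboolP.
Qed.

Lemma infinite_setI_almost (X Y : set nat) :
  infinite_set X -> finite_set (X `\` Y) -> infinite_set (X `&` Y).
Proof.
move=> Xinf XY XYfin; apply: Xinf; rewrite -(setDUK (@subIsetl _ X Y)).
by rewrite finite_setU setDIr setDv set0U.
Qed.

(** The usual pseudo-intersection: [u k] is picked in the first [k.+1] representatives. *)
Lemma PomegaFin_sigma_closed (r : nat -> PomegaFin_pos) :
  (forall n, r n.+1 <= r n)%O -> exists x, forall n, (x <= r n)%O.
Proof.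
move=> rS; have rle m n : (m <= n)%N -> (r n <= r m)%O.
  by apply: (homo_leq (r := fun x y => (y <= x)%O)) => // y x z xy yz;
    exact: le_trans yz xy.
have [u [um uP]] : exists u : nat -> nat, {homo u : m n / (m < n)%N} /\
    forall k i, (i <= k)%N -> rep (r i) (u k).
  apply: (increasing_choice (R := fun k m =>
    forall i, (i <= k)%N -> rep (r i) m)) => k N.
  have fin : finite_set (\bigcup_(i in `I_k.+1) (rep (r k) `\` rep (r i))).
    apply: bigcup_finite; first exact: finite_II.
    by move=> i; rewrite /= ltnS => /rle/PomegaFin_leE.
  have := infinite_setD (@rep_infinite (r k)) fin.
  move=> /infinite_natP/(_ N)[m Nm [km nm]]; exists m => // i ik.
  by apply: contrapT => nim; apply: nm; exists i.
have [x [xu _]] := PomegaFin_class (homo_ltn_range um).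
exists x => n; apply/PomegaFin_leE; apply: finite_setD_trans xu _.
apply: (@sub_finite_set _ _ (u @` `I_n)); last exact/finite_image/finite_II.
move=> _ [[k _ <-] nk]; exists k => //=; rewrite ltnNge; apply/negP => kn.
by apply: nk; exact: uP.
Qed.

Section Quotient.
Context {d : Order.disp_t} {alpha : orderType d}.
Variables (pos : set alpha -> Prop) (U : set nat -> set alpha).
Hypothesis fib : fibered pos U.
Variable c : alpha -> nat.
Hypothesis c_inj : injective c.
Implicit Types (x y : PomegaFin_pos) (A B C D : set alpha) (X Y : set nat).

Let V x := U (rep x).

Let up A B : A `<=` B -> pos A -> pos B.
Proof. exact: fib_up fib _ _. Qed.

Let U_mono X Y : X `<=` Y -> U X `<=` U Y.
Proof. by move=> /setIidl <-; rewrite (fib_setI fib); exact: subIsetr. Qed.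

Definition redP x B := red pos U (rep x) B.

(** A test set inside [X'] meets [X] in an infinite set, so [red] depends only on the class modulo
    finite sets. *)
Lemma red_almost X X' B : finite_set (X' `\` X) -> red pos U X B -> red pos U X' B.
Proof.
move=> XX' Br Y YX' Yinf; apply: up (Br (Y `&` X) _ _); last 2 first.
- by move=> n [].
- apply: infinite_setI_almost => //; apply: sub_finite_set XX' => n [Yn nX].
  by split=> //; exact: YX'.
by move=> a [Ba Ua]; split=> //; apply: U_mono Ua => n [].
Qed.

Lemma redP_le x y B : (x <= y)%O -> redP y B -> redP x B.
Proof. by move=> /PomegaFin_leE; exact: red_almost. Qed.

Lemma redP_pos x B : redP x B -> pos (B `&` V x).
Proof. by apply=> //; exact: rep_infinite. Qed.

(** If [X] reduces [C], then [C] meets [U X] in a positive set contained in [V x] and [V y], so [X]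
    meets both representatives in a common infinite set. *)
Lemma pos_redP C x y : pos C -> C `<=` V x -> C `<=` V y ->
  exists z, [/\ (z <= x)%O, (z <= y)%O & redP z C].
Proof.
move=> Cpos Cx Cy; have [X Xinf Xr] := fib_red fib Cpos.
have Winf : infinite_set (rep x `&` rep y `&` X).
  apply: (fib_inf fib); rewrite !(fib_setI fib).
  apply: up (Xr X _ Xinf) => // a [Ca Xa].
  by split=> //; split; [exact: Cx|exact: Cy].
have [z [zW _]] := PomegaFin_class Winf; exists z; split.
- by apply/PomegaFin_leE; apply: sub_finite_set zW => n [zn nx]; split=> // -[[]].
- by apply/PomegaFin_leE; apply: sub_finite_set zW => n [zn nx]; split=> // -[[]].
- apply: red_almost Xr; apply: sub_finite_set zW => n [zn nx].
  by split=> // -[].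
Qed.

(** Any infinite test set names a condition, and a denser one reducing [B] still meets it infinitely
    often. Forced membership holds only densely, hence the need for locality. *)
Lemma redP_local x B : dense_below x (fun y => redP y B) -> redP x B.
Proof.
move=> dx Y Yx Yinf; have [y [yY Yy]] := PomegaFin_class Yinf.
have yx : (y <= x)%O.
  by apply/PomegaFin_leE; apply: sub_finite_set yY => n [yn nx]; split=> // /Yx.
have [z zy zB] := dx y yx.
apply: up (zB (rep z `&` Y) _ _); last 2 first.
- by move=> n [].
- apply: infinite_setI_almost; first exact: rep_infinite.
  by apply: finite_setD_trans yY; exact/PomegaFin_leE.
by move=> a [Ba Ua]; split=> //; apply: U_mono Ua => n [].
Qed.

Lemma redP_setT x : redP x setT.
Proof. by move=> Y _ /(fib_pos fib); rewrite setTI. Qed.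

(** Since [x <= y] is inclusion up to a finite set, [V x] need not be contained in [V y]; positivity
    does not see the difference. *)
Lemma pos_V_le x y B : (x <= y)%O -> pos (B `&` V x) -> pos (B `&` V x `&` V y).
Proof.
move=> xy Bx; have [|a []//|z [zx _ zB]] := pos_redP Bx (x := x) (y := x).
  by move=> a [].
apply: up (zB (rep z `&` rep y) _ _); last 2 first.
- by move=> n [].
- apply: infinite_setI_almost; first exact: rep_infinite.
  by apply/PomegaFin_leE; exact: le_trans xy.
by move=> a [Ba Ua]; split=> //; apply: U_mono Ua => n [].
Qed.

(* [x] forces [B <= B'] in the separative quotient. *)
Definition leG x B B' := forall C, C `<=` B `&` V x -> pos C -> pos (C `&` B').

Lemma leG_le x y B B' : (x <= y)%O -> leG y B B' -> leG x B B'.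
Proof.
move=> xy yB C CB Cpos.
have Cx : C `&` V x = C by apply/setIidl => a /CB[].
rewrite -Cx in Cpos; have := pos_V_le xy Cpos; rewrite Cx => Cy.
apply: up (yB (C `&` V y) _ Cy) => [a [[]]//|a [Ca ya]].
by split=> //; case: (CB a Ca).
Qed.

Lemma leG_local x B B' : dense_below x (fun y => leG y B B') -> leG x B B'.
Proof.
move=> dx C CB Cpos; have Cx a : C a -> V x a by move=> /CB[].
have [y [yx _ yC]] := pos_redP Cpos Cx Cx; have [z zy zB] := dx y yx.
apply: up (zB (C `&` V z) _ (redP_pos (redP_le zy yC))) => [a [[]]//|a [Ca Vz]].
by split=> //; case: (CB a Ca).
Qed.

Lemma leG_sub x B B' : B `<=` B' -> leG x B B'.
Proof. by move=> BB' C CB; apply: up => a Ca; split=> //; case: (CB a Ca) => /BB'. Qed.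

Lemma leG_trans x A B C : leG x A B -> leG x B C -> leG x A C.
Proof.
move=> AB BC D DA /(AB _ DA) Dpos; apply: up (BC _ _ Dpos) => [a [[]]//|a [Da Ba]].
by split=> //; case: (DA a Da).
Qed.

(** * The name of the quotient and its forced properties *)

Local Notation PF := PomegaFin_pos.

(** A canonical name for the image of [B] under [c]: numerals stand for the points of alpha because
    equality of numerals is decided. *)
Definition code B : name PF :=
  Name (fun a : {a | B a} => nat_name (c (sval a))) (fun=> \top).

Lemma code_inj A B (p : PF) : feq (code A) (code B) p -> A = B.
Proof.
have sub A' B' : feq (code A') (code B') p -> A' `<=` B'.
  move=> e a Aa; have : fmem (nat_name (c a)) (code B') p.
    apply: fmem_eqr e _.
    by apply: (@fmem_elt _ _ (code A') (exist _ a Aa)); exact: lex1.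
  move=> /(_ p (lexx p))[q _ [[a' Ba'] _ /nat_name_inj/c_inj e']].
  by rewrite e'.
by move=> e; apply/seteqP; split; apply: sub => //; exact: feq_sym.
Qed.

(** Since [redP] and [leG] are local, attaching the conditions that satisfy them makes them coincide
    with forced membership and order, as [fmem_code] and [fle_code] show. *)
Definition quotient_po : po_name PF := @PoName PF
  (Name (fun z : {z : set alpha * PF | redP z.2 z.1} => code (sval z).1)
        (fun z => (sval z).2))
  (Name (fun z : {z : set alpha * set alpha * PF | leG z.2 z.1.1 z.1.2} =>
           opair_name (code (sval z).1.1) (code (sval z).1.2))
        (fun z => (sval z).2))
  (exist _ (setT, \top) (@redP_setT \top)).

Lemma fmem_code B (p : PF) : fmem (code B) (po_set quotient_po) p <-> redP p B.
Proof.
split=> [h|pB].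
  apply: redP_local; apply: (dense_below_bind h) => q _ [[[B' x] /= xB'] qx].
  by move=> /code_inj ->; apply: dense_below_now => r rq;
    apply: redP_le xB'; exact: le_trans qx.
pose z : {z : set alpha * PF | redP z.2 z.1} := exist _ (B, p) pB.
by apply: (@fmem_elt _ _ (po_set quotient_po) z); exact: lexx.
Qed.

Lemma fle_code B B' (p : PF) : fle quotient_po (code B) (code B') p <-> leG p B B'.
Proof.
split=> [h|pB].
  apply: leG_local; apply: (dense_below_bind h) => q _ [[[[C C'] x] /= xC] qx].
  move=> /(opair_code_inj code_inj)[-> ->]; apply: dense_below_now => r rq.
  by apply: leG_le xC; exact: le_trans qx.
pose z : {z : set alpha * set alpha * PF | leG z.2 z.1.1 z.1.2} :=
  exist _ (B, B', p) pB.
by apply: (@fmem_elt _ _ (po_rel quotient_po) z); exact: lexx.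
Qed.

Lemma fmem_po_set (x : name PF) p : fmem x (po_set quotient_po) p ->
  dense_below p (fun q => exists2 B, redP q B & feq x (code B) q).
Proof.
move=> /dense_below_bind; apply=> q _ [[[B y] /= yB] qy xB].
apply: dense_below_now => r rq; exists B; last exact: feq_le xB.
by apply: redP_le yB; exact: le_trans qy.
Qed.

Lemma fle_feq (x y x' y' : name PF) p : feq x x' p -> feq y y' p ->
  fle quotient_po x y p -> fle quotient_po x' y' p.
Proof. by move=> xx yy; apply: fmem_eql; exact: feq_opair. Qed.

Lemma fle_as_code (x y : name PF) B B' p : feq x (code B) p -> feq y (code B') p ->
  fle quotient_po x y p <-> leG p B B'.
Proof.
move=> xB yB'; split; first by move=> /(fle_feq xB yB')/fle_code.
by move=> /fle_code; apply: fle_feq; exact: feq_sym.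
Qed.

Lemma quotient_is_forcing : (\top : PF) ||- is_forcing quotient_po.
Proof.
split; [|split; [|split]].
- exact/fmem_code/redP_setT.
- move=> x p _ /fmem_po_set/dense_below_bind; apply=> q _ [B _ xB].
  by apply/(fle_as_code xB xB); exact: leG_sub.
- move=> x p1 _ xp y p2 p21 yp z p3 p32 zp p4 p43 [xy yz].
  have p42 := le_trans p43 p32; have p41 := le_trans p42 p21.
  apply: (dense_below_bind (fmem_po_set (fmem_le p41 xp))) => q1 q1p [A _ xA].
  apply: (dense_below_bind (fmem_po_set (fmem_le (le_trans q1p p42) yp))) => q2 q21 [B _ yB].
  apply: (dense_below_bind (fmem_po_set (fmem_le (le_trans q21 (le_trans q1p p43)) zp)))
    => q3 q32 [C _ zC].
  have {}xA := feq_le (le_trans q32 q21) xA; have {}yB := feq_le q32 yB.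
  have q3p := le_trans q32 (le_trans q21 q1p).
  apply/(fle_as_code xA zC); apply: (leG_trans (B := B)).
    by apply/(fle_as_code xA yB); exact: fmem_le xy.
  by apply/(fle_as_code yB zC); exact: fmem_le yz.
- move=> x p _ /fmem_po_set/dense_below_bind; apply=> q _ [B _ xB].
  by apply/(fle_as_code xB (feq_refl _ _)); exact: leG_sub.
Qed.

Definition quotient_forcing : forcing_name PF := ForcingName quotient_is_forcing.

Lemma fcompatible_pos (x y : name PF) B B' p :
  feq x (code B) p -> feq y (code B') p ->
  fcompatible quotient_po x y p -> pos (B `&` B').
Proof.
move=> xB yB' /(_ p (lexx p))[q qp [t [tpi [tx ty]]]].
have [r rq [C rC tC]] := fmem_po_set tpi (lexx q).
have rp := le_trans rq qp.
have /(fle_as_code tC (feq_le rp xB)) CB := fmem_le rq tx.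
have /(fle_as_code tC (feq_le rp yB')) CB' := fmem_le rq ty.
have h1 : C `&` V r `<=` C `&` V r by [].
have h2 : C `&` V r `&` B `<=` C `&` V r by move=> a [].
by apply: up (CB' _ h2 (CB _ h1 (redP_pos rC))) => a [[]].
Qed.

Lemma quotient_separative : (\top : PF) ||- separative quotient_forcing.
Proof.
move=> x p1 _ xp y p2 p21 yp p3 p32 nxy q qp3.
have q2 := le_trans qp3 p32.
have [q1 q1q [B _ xB]] := fmem_po_set (fmem_le (le_trans q2 p21) xp) (lexx q).
have [r rq1 [B' _ yB']] := fmem_po_set (fmem_le (le_trans q1q q2) yp) (lexx q1).
have {}xB := feq_le rq1 xB; have rq := le_trans rq1 q1q.
(* A set [C] refuting [leG] is itself the separating condition. *)
have /existsNP[C /not_implyP[CB /not_implyP[Cpos nC]]] : ~ leG r B B'.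
  by move=> /(fle_as_code xB yB'); apply: nxy; exact: le_trans qp3.
have [|a /CB[]//|s [sr _ sC]] := pos_redP Cpos (x := r) (y := r).
  by move=> a /CB[].
exists s; first exact: le_trans rq.
exists (code C); split; [exact/fmem_code|split].
  apply/(fle_as_code (feq_refl _ _) (feq_le sr xB)); apply: leG_sub => a.
  by move=> /CB[].
move=> t ts tC; apply: nC.
exact: fcompatible_pos (feq_refl _ _) (feq_le (le_trans ts sr) yB') tC.
Qed.

Lemma quotient_atomless : (\top : PF) ||- atomless quotient_forcing.
Proof.
move=> x p1 _ xp q qp1.
have [r rq [B rB xB]] := fmem_po_set (fmem_le qp1 xp) (lexx q).
have [X [C [C' [Xinf Xr [CB CB'] [XC XC'] nCC]]]] :=
  fib_split fib (@rep_infinite r) rB.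
have [s [sX _]] := PomegaFin_class Xinf.
have sr : s <= r.
  by apply/PomegaFin_leE; apply: sub_finite_set sX => n [sn nr]; split=> // /Xr.
have sC : redP s C := red_almost sX XC.
have sC' : redP s C' := red_almost sX XC'.
exists s; first exact: le_trans rq.
exists (code C); split; first exact/fmem_code.
apply: dense_below_now => t ts; have tr := le_trans ts sr.
exists (code C'); split; first by apply/fmem_code; exact: redP_le sC'.
split; first by apply/(fle_as_code (feq_refl _ _) (feq_le tr xB)); exact: leG_sub.
split; first by apply/(fle_as_code (feq_refl _ _) (feq_le tr xB)); exact: leG_sub.
by move=> t' _ /(fcompatible_pos (feq_refl _ _) (feq_refl _ _)).
Qed.

Lemma quotient_omega1_closed : (\top : PF) ||- omega1_closed quotient_forcing.
Proof.
move=> f p _ [[_ [ftot ffun]] fdec] q qp.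
(* [F] decides one term of the sequence as a code. Iterating it and taking a lower bound gives a
   single [r] that decides the whole sequence as the ground-model sets [B n]. *)
have /choice[F FP] : forall nr : nat * PF, exists r' : PF * set alpha, nr.2 <= p ->
    [/\ r'.1 <= nr.2, redP r'.1 r'.2 & fmem (opair_name (nat_name nr.1) (code r'.2)) f r'.1].
  move=> [n r] /=; have [rp|] := boolP (r <= p); last by exists (r, setT).
  have [r1 r1r [x [xpi xf]]] := ftot n r rp.
  have [r2 r21 [B r2B xB]] := fmem_po_set xpi (lexx r1).
  exists (r2, B) => _; split=> //=; first exact: le_trans r1r.
  by apply: fmem_eql (fmem_le r21 xf); apply: feq_opair xB; exact: feq_refl.
pose fix R n : PF * set alpha := F (n, if n is m.+1 then (R m).1 else q).
pose prev n := if n is m.+1 then (R m).1 else q.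
have RF n : R n = F (n, prev n) by case: n.
have prevp n : prev n <= p.
  elim: n => //= n IH; apply: le_trans (IH); rewrite RF.
  by have [] := FP (n, prev n) IH.
have RP n : [/\ (R n).1 <= prev n, redP (R n).1 (R n).2 &
    fmem (opair_name (nat_name n) (code (R n).2)) f (R n).1].
  by rewrite RF; exact: FP (n, prev n) (prevp n).
pose B n := (R n).2.
have [r rR] : exists r, forall n, r <= (R n).1.
  by apply: PomegaFin_sigma_closed => n; have [] := RP n.+1.
have rf n : fmem (opair_name (nat_name n) (code (B n))) f r.
  by have [_ _] := RP n; exact: fmem_le.
have rB n : redP r (B n) by apply: redP_le (rR n) _; have [] := RP n.
have rq : r <= q by apply: le_trans (rR 0%N) _; have [] := RP 0%N.
have rp := le_trans rq qp.
have rdec n : leG r (B n.+1) (B n).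
  by apply/fle_code; apply: (fdec n (code (B n)) (code (B n.+1)) r rp).
(* [leG] is weaker than inclusion: finite intersections make the sequence decreasing for inclusion,
   as [fib_fusion] requires, and [rB'] keeps them positive. *)
pose B' n := [set a | forall i, (i <= n)%N -> B i a].
have rB' n C : C `<=` B n `&` V r -> pos C -> pos (C `&` B' n).
  elim: n C => [|n IH] C CB Cpos.
    by apply: up Cpos => a Ca; split=> // i; rewrite leqn0 => /eqP->; case: (CB a Ca).
  have h : C `&` B n `<=` B n `&` V r by move=> a [/CB[]].
  apply: up (IH _ h (rdec n C CB Cpos)) => a [[Ca _] Ba]; split=> // i.
  by rewrite leq_eqVlt ltnS => /orP[/eqP->|/Ba//]; case: (CB a Ca).
have [||X [A [Xinf Xr XA AB']]] := fib_fusion fib (B := B') (@rep_infinite r).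
- by move=> k a Ba i ik; apply: Ba; exact: leqW.
- move=> k Y Yr Yinf; apply: up (rB' k _ _ (rB k Y Yr Yinf)) => a.
    by move=> [[_ Ya] Ba].
  by move=> [Ba Ya]; split=> //; exact: U_mono Ya.
have [s [sX _]] := PomegaFin_class Xinf.
have sr : s <= r.
  by apply/PomegaFin_leE; apply: sub_finite_set sX => n [sn nr]; split=> // /Xr.
exists s; first exact: le_trans rq.
exists (code A); split; first by apply/fmem_code; exact: red_almost sX XA.
move=> n x t ts xf.
have tr := le_trans ts sr.
have xB : feq x (code (B n)) t.
  by apply: (ffun n x (code (B n)) t (le_trans tr rp)); split=> //; exact: fmem_le (rf n).
apply/(fle_as_code (feq_refl _ _) xB) => C CA Cpos.
apply: up (AB' n C _ Cpos) => [a [Ca Ba]|a /CA[]//].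
by split=> //; exact: Ba.
Qed.

(** * Dense maps into the positive sets *)

Definition positive : Type := {B | pos B}.

(** The separative order induced by inclusion on the positive sets. *)
Definition positive_le (A B : positive) : Prop :=
  forall C, C `<=` sval A -> pos C -> pos (C `&` sval B).

Lemma positive_le_trans (m n o : positive) :
  positive_le m n -> positive_le n o -> positive_le m o.
Proof.
move=> mn no D Dm /(mn _ Dm) Dpos.
by apply: up (no _ _ Dpos) => [a [[]]//|a []].
Qed.

Lemma positive_le_sub (m n : positive) : sval m `<=` sval n -> positive_le m n.
Proof. by move=> mn C Cm; apply: up => a Ca; split=> //; exact/mn/Cm. Qed.

Lemma positive_leI (m n o : positive) : positive_le m n -> positive_le m o ->
  pos (sval m `&` sval n `&` sval o).
Proof. by move=> mn mo; apply: mo => [a []//|]; apply: mn => //; exact: (svalP m). Qed.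

Lemma iteration_red (z : iteration quotient_forcing) :
  redP (sval z).1 (sval (sval z).2).1.
Proof. by apply/fmem_code; exact: (svalP z). Qed.

Definition iteration_set (z : iteration quotient_forcing) : positive :=
  exist _ _ (redP_pos (@iteration_red z)).

Lemma iteration_set_le z z' : z <= z' ->
  positive_le (iteration_set z) (iteration_set z').
Proof.
move=> /andP[xx' /asboolP/fle_code BB'] C CB Cpos.
have Cx : C `&` V (sval z).1 = C by apply/setIidl => a /CB[].
have := BB' C CB Cpos; set C' := C `&` _ => C'pos.
have C'x : C' `&` V (sval z).1 = C' by apply/setIidl => a [/CB[]].
rewrite -C'x in C'pos; have := pos_V_le xx' C'pos; rewrite C'x.
by apply: up => a [[Ca Ba] Va].
Qed.

(** The part [E] of [m] inside both sets is positive; a condition [x] that reduces it, below both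
    first coordinates, gives the extension with second coordinate [E]. *)
Lemma iteration_below (m : positive) z z' : positive_le m (iteration_set z) ->
  positive_le m (iteration_set z') ->
  exists r, [/\ r <= z, r <= z' & sval (iteration_set r) `<=` sval m].
Proof.
move=> mz mz'; have Epos := positive_leI mz mz'.
set E := sval m `&` _ `&` _ in Epos.
have [||x [xz xz' xE]] := pos_redP Epos (x := (sval z).1) (y := (sval z').1).
- by move=> a [[_ []]].
- by move=> a [_ []].
pose i : dom (po_set quotient_forcing) := exist _ (E, x) xE.
have xi : x ||- fmem (elt i) (po_set quotient_forcing) by apply/fmem_code.
exists (exist _ (x, i) xi); split.
- by apply/andP; split=> //; apply/asboolP/fle_code; apply: leG_sub => a [[_ []]].
- by apply/andP; split=> //; apply/asboolP/fle_code; apply: leG_sub => a [_ []].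
- by move=> a [[[]]].
Qed.

Lemma positive_le_refl m : positive_le m m.
Proof. exact: positive_le_sub. Qed.

Lemma iteration_dense m : exists z, positive_le (iteration_set z) m.
Proof.
have [X Xinf Xm] := fib_red fib (svalP m).
have [x [xX _]] := PomegaFin_class Xinf.
pose i : dom (po_set quotient_forcing) := exist _ (sval m, x) (red_almost xX Xm).
have xi : x ||- fmem (elt i) (po_set quotient_forcing).
  by apply/fmem_code; exact: red_almost xX Xm.
by exists (exist _ (x, i) xi); apply: positive_le_sub => a [].
Qed.

Section DensePoset.
Context {d' : Order.disp_t} (Q : tPreorderType d') (e : Q -> positive).
Hypotheses (e_mono : forall p q, p <= q -> positive_le (e p) (e q))
  (e_dense : forall m, exists p, positive_le (e p) m)
  (e_compat : forall m p q, positive_le m (e p) -> positive_le m (e q) ->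
     exists2 r, r <= p & r <= q).

Lemma quotient_forcing_equivalent :
  forcing_equivalent Q (iteration quotient_forcing).
Proof.
have compat m z z' : positive_le m (iteration_set z) ->
    positive_le m (iteration_set z') -> exists2 r, r <= z & r <= z'.
  by move=> mz mz'; have [r [rz rz' _]] := iteration_below mz mz'; exists r.
split.
  exact: (extensions_included_dense positive_le_refl positive_le_trans e_mono
    iteration_set_le e_dense iteration_dense e_compat compat).
exact: (extensions_included_dense positive_le_refl positive_le_trans
  iteration_set_le e_mono iteration_dense e_dense compat e_compat).
Qed.

End DensePoset.

End Quotient.

(** * Copies of alpha as a dense family of positive sets *)

Section CopiesDense.
Context {d : Order.disp_t} {alpha : orderType d}.

Lemma copy_emb (B : copies alpha) : emb setT (sval B).
Proof.
by have /asboolP[f [fB _ _] fm] := svalP B; exists f; split=> [x _|x y _ _];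
  [exact: fB|rewrite fm].
Qed.

Lemma emb_copy (A : set alpha) : emb setT A ->
  exists B : copies alpha, sval B `<=` A.
Proof.
move=> [f [fA fm]]; suff rf : is_copy (range f).
  by exists (exist _ (range f) (asboolT rf)) => _ [x _ <-]; exact: fA.
have fM : {mono f : x y / x < y} by apply: leW_mono; apply: le_mono => x y; exact: fm.
exists f => //; split=> [x _|x y _ _ fxy|_ [x _ <-]]; try by exists x.
by case: (ltgtP x y) => //; rewrite -fM fxy ltxx.
Qed.

Definition copy_positive (B : copies alpha) : positive (fun A => emb setT A) :=
  exist _ (sval B) (copy_emb B).

Lemma copies_leE (A B : copies alpha) : A <= B <-> sval A `<=` sval B.
Proof. by rewrite -Order.le_val subsetEset. Qed.

End CopiesDense.

Lemma well_order_min (d : Order.disp_t) (alpha : orderType d) :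
  well_order (<=%O : rel alpha) -> forall A : set alpha, A !=set0 ->
  exists2 x, A x & forall y, A y -> x <= y.
Proof.
move=> wo A [a Aa]; have [|x [[xA xmin] _]] := wo [pred x | `[< A x >]].
  by exists a; apply/asboolP.
by exists x => [|y Ay]; [apply/asboolP|apply: xmin; apply/asboolP].
Qed.

Theorem theorem5p3 (d : Order.disp_t) (alpha : orderType d)
    (alpha_wo : well_order (<=%O : rel alpha))
    (alpha_countable : countable [set: alpha])
    (alpha_ge : ordinal_le omega_plus_omega alpha) :
  exists pi : forcing_name PomegaFin_pos,
    ((\top : PomegaFin_pos) ||-
       (omega1_closed pi /\ separative pi /\ atomless pi)) /\
    forcing_equivalent (copies alpha) (iteration pi).
Proof.
have [h hm hinit] := alpha_ge.
(* The summands [false] and [true] of omega + omega supply [e] and [w]; as [h] maps onto an initial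
   segment, so does [e]. *)
have [//|||n|n x xn|U fib] := @fibered_copies _ _ (well_order_min alpha_wo)
  (fun n => h (false, n)) (fun n => h (true, n)).
- by move=> m n mn; rewrite hm.
- by move=> m n mn; rewrite hm.
- by rewrite hm.
- have [[[] m] hx] := hinit (false, n) x xn; last by exists m.
  have : h (false, n) < h (true, m) by rewrite hm.
  by rewrite hx ltNge xn.
have /countable_injP[c c_inj] := alpha_countable.
have {}c_inj : injective c by move=> x y; apply: c_inj; rewrite inE.
exists (quotient_forcing fib c_inj); split.
  split; first exact: quotient_omega1_closed.
  by split; [exact: quotient_separative|exact: quotient_atomless].
apply: (quotient_forcing_equivalent fib c_inj (e := @copy_positive d alpha)).
- by move=> A B /copies_leE AB; exact: (positive_le_sub fib).
- by move=> m; have [B Bm] := emb_copy (svalP m); exists B; exact: (positive_le_sub fib).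
- move=> m A B mA mB; have [C CE] := emb_copy (positive_leI mA mB).
  by exists C; apply/copies_leE => x /CE[[]].
Qed.
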